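(* Let $a \in (0,1)$, let $C \in \mathbb{R}$, and let $f \in L^1(\mathbb{R})$ satisfy $$|f(x)| \le C e^{-ax^2/2} \quad\text{and}\quad |\hat f(\xi)| \le C e^{-a\xi^2/2}$$ for all $x, \xi \in \mathbb{R}$. Then $$|\langle f, \varphi_k\rangle| \le C \sqrt{\frac{2\pi\, k!}{1+a}}\,\left(\frac{e}{k}\right)^{k/2}\left(\frac{1-a}{1+a}\right)^{k/4}$$ for $k = 1, 2, \dots$.
   Context: Functions are complex-valued. The Fourier transform of $f \in L^1(\mathbb{R})$ is $\hat f(\xi) = \frac{1}{\sqrt{2\pi}}\int_{\mathbb{R}} f(x) e^{-i\xi x}\,dx$. The inner product and norm on $L^2(\mathbb{R})$ are taken with respect to the measure $dm = dx/\sqrt{2\pi}$, i.e. $\langle f, g\rangle = \int_{\mathbb{R}} f(x)\overline{g(x)}\,\frac{dx}{\sqrt{2\pi}}$. For $k \ge 0$, $\varphi_k$ denotes the $k$-th Hermite function normalized in $L^2(\mathbb{R}, dm)$: $\varphi_k(x) = 2^{1/4}(2^k k!)^{-1/2} H_k(x) e^{-x^2/2}$, where $H_k(x) = (-1)^k e^{x^2}\frac{d^k}{dx^k}e^{-x^2}$. Pointwise bounds on $f$ are understood almost everywhere. *)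

(* Defs.v *)
From HB Require Import structures.
From mathcomp Require Import all_boot all_order all_algebra.
From mathcomp Require Import complex.
From mathcomp Require Import all_classical all_reals all_analysis.

Set Implicit Arguments.
Unset Strict Implicit.
Unset Printing Implicit Defensive.

Import Order.TTheory GRing.Theory Num.Theory.
Import numFieldNormedType.Exports.

Local Open Scope classical_set_scope.
Local Open Scope ring_scope.
Local Open Scope complex_scope.

Section Defs.
Context {R : realType}.
Local Notation mu := (@lebesgue_measure R).

(* Complex-valued functions are integrated componentwise: the library's
   integral is for extended-real-valued functions. *)
Definition cintegrable (f : R -> R[i]) : Prop :=
  mu.-integrable setT (fun x => (complex.Re (f x))%:E) /\
  mu.-integrable setT (fun x => (complex.Im (f x))%:E).

Definition cintegral (f : R -> R[i]) : R[i] :=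
  (\int[mu]_x complex.Re (f x)) +i* (\int[mu]_x complex.Im (f x)).

Definition expi (t : R) : R[i] := cos t +i* sin t.

Definition fourier (f : R -> R[i]) (xi : R) : R[i] :=
  ((Num.sqrt (2 * pi))^-1)%:C
    * cintegral (fun x => f x * expi (- (xi * x))).

(* inner product for dm = dx / sqrt (2 pi), antilinear in the second variable *)
Definition inner (f g : R -> R[i]) : R[i] :=
  cintegral (fun x => f x * (g x)^* * ((Num.sqrt (2 * pi))^-1)%:C).

(* physicists' Hermite polynomials, by Rodrigues' formula *)
Definition hermite (k : nat) (x : R) : R :=
  (-1) ^+ k * expR (x ^+ 2) * ((fun y : R => expR (- y ^+ 2))^`(k))%classic x.

Definition hermite_fun (k : nat) (x : R) : R[i] :=
  (2 `^ (4^-1) * (Num.sqrt (2 ^+ k * k`!%:R))^-1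
    * hermite k x * expR (- x ^+ 2 / 2))%:C.

End Defs.

(* Main.v *)
Require Import Defs.
From mathcomp Require Import all_boot all_order all_algebra.
From mathcomp Require Import complex.
From mathcomp Require Import all_classical all_reals all_analysis.
From mathcomp Require Import measurable_realfun.
From mathcomp Require Import ring lra.
Import Order.TTheory GRing.Theory Num.Theory.
Import numFieldNormedType.Exports.
Local Open Scope classical_set_scope.
Local Open Scope ring_scope.
Local Open Scope complex_scope.

Set Implicit Arguments.
Unset Strict Implicit.

(** The Bargmann transform
      F t = (2 pi)^(-1/2) * \int f(x) exp (2 x t - t^2 - x^2 / 2) dx
    is entire, and its k-th Taylor coefficient is <f, H_k exp (- x^2 / 2)> / k!.
    Put b = (1 - a) / (1 + a) and K = C / sqrt (1 + a).  The bound on f gives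
    |F (u + iv)| <= K exp (b u^2 + v^2), and the bound on the Fourier transform
    gives, by Parseval's formula, |F (u + iv)| <= K exp (u^2 + b v^2).  On the
    rays of argument pi/4 +- asin(a)/2 these yield
    |F t exp (i sqrt b t^2)| <= K, and the Phragmen-Lindelof principle in the
    sector between the rays, of opening less than pi/2, improves the bounds to
    |F t| <= K exp (sqrt b |t|^2).  Cauchy's estimate on the circle
    |t|^2 = k / (2 sqrt b) then gives the theorem, with 2^(1/4) in place of
    sqrt (2 pi). *)

(** The rays are forced. At t = r exp (i (pi/4 + y)) the better of the two bounds has exponent r^2
    (1 - a |sin 2y|) / (1 + a), while exp (i sqrt b t^2) has modulus exp (- sqrt b r^2 cos 2y).
    Their product is at most K exactly when sqrt (1 - a^2) cos 2y + a |sin 2y| >= 1, that is cos (2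
    |y| - asin a) = 1, so only |y| = asin(a)/2 will do. Between these rays and the axes the exponent
    is at most (1 - a) r^2, and 1 - a <= sqrt b, so the maximum principle is needed only between the
    rays. Their angle asin a is less than pi/2, the critical opening for growth exp (|t|^2), because
    a < 1. The transform is neither expanded in a power series nor integrated along a contour.
    Complex differentiability is [jet2], which is stable under sums, products and composition and
    suffices for a maximum principle on rectangles; logarithmic coordinates turn the sector into a
    strip. Taylor coefficients are reached through finite averages over roots of unity, applied to a
    truncated generating function of the Hermite polynomials. *)

Notation normc := ComplexField.Normc.normc.
Notation Re := complex.Re.
Notation Im := complex.Im.

(** * The complex exponential *)

Section Complex.
Context {R : realType}.
Implicit Types (z w u : R[i]) (x y s t : R).

Lemma normcE z : normc z = Num.sqrt (Re z ^+ 2 + Im z ^+ 2).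
Proof. by case: z. Qed.

Lemma normc_norm z : `|z| = (normc z)%:C.
Proof. by []. Qed.

Lemma normc_ge0 z : 0 <= normc z.
Proof. by rewrite normcE sqrtr_ge0. Qed.

Lemma sqr_normcE z : normc z ^+ 2 = Re z ^+ 2 + Im z ^+ 2.
Proof. by rewrite normcE sqr_sqrtr// addr_ge0 ?sqr_ge0. Qed.

Lemma normcM z w : normc (z * w) = normc z * normc w.
Proof. exact: ComplexField.Normc.normcM. Qed.

Lemma normc0 : normc (0 : R[i]) = 0.
Proof. exact: ComplexField.Normc.normc0. Qed.

Lemma normc1 : normc (1 : R[i]) = 1.
Proof. exact: ComplexField.Normc.normc1. Qed.

Lemma normcX z n : normc (z ^+ n) = normc z ^+ n.
Proof. by elim: n => [|n IH]; rewrite ?expr0 ?normc1// !exprS normcM IH. Qed.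

Lemma normcV z : normc z^-1 = (normc z)^-1.
Proof. exact: ComplexField.Normc.normcV. Qed.

Lemma le_normcD z w : normc (z + w) <= normc z + normc w.
Proof. exact: complex.le_normcD. Qed.

Lemma normcN z : normc (- z) = normc z.
Proof. exact: complex.normcN. Qed.

Lemma le_normcB z w : normc (z - w) <= normc z + normc w.
Proof. by rewrite -(normcN w) le_normcD. Qed.

Lemma normc_real x : normc x%:C = `|x|.
Proof. by rewrite normcE /= expr0n/= addr0 sqrtr_sqr. Qed.

Lemma normc_nat n : normc (n%:R : R[i]) = n%:R.
Proof.
by rewrite (_ : n%:R = (n%:R : R)%:C) ?normc_real ?normr_nat// rmorph_nat.
Qed.

Lemma normc_eq0 z : normc z = 0 -> z = 0.
Proof. exact: ComplexField.Normc.eq0_normc. Qed.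

Lemma le_normc_sum (I : Type) (r : seq I) (P : pred I) (F : I -> R[i]) :
  normc (\sum_(i <- r | P i) F i) <= \sum_(i <- r | P i) normc (F i).
Proof.
elim/big_ind2 : _ => //; first by rewrite normc0.
by move=> a b c d ab cd; apply: le_trans (le_normcD _ _) (lerD _ _).
Qed.

Lemma ler_Re_normc z : `|Re z| <= normc z.
Proof.
rewrite normcE -sqrtr_sqr ler_wsqrtr// lerDl sqr_ge0//.
Qed.

Lemma ler_Im_normc z : `|Im z| <= normc z.
Proof.
rewrite normcE -sqrtr_sqr ler_wsqrtr// lerDr sqr_ge0//.
Qed.

Lemma le_normc_ReIm z : normc z <= `|Re z| + `|Im z|.
Proof.
rewrite normcE -(ler_pXn2r (n := 2))// ?nnegrE ?sqrtr_ge0 ?addr_ge0//.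
rewrite sqr_sqrtr ?addr_ge0 ?sqr_ge0// sqrrD !real_normK ?num_real//.
by rewrite lerD2r lerDl mulrn_wge0// mulr_ge0.
Qed.

Lemma complex_eq z w : Re z = Re w -> Im z = Im w -> z = w.
Proof. by case: z => a b; case: w => c d /= -> ->. Qed.

Lemma ReD z w : Re (z + w) = Re z + Re w. Proof. by case: z; case: w. Qed.
Lemma ImD z w : Im (z + w) = Im z + Im w. Proof. by case: z; case: w. Qed.
Lemma ReN z : Re (- z) = - Re z. Proof. by case: z. Qed.
Lemma ImN z : Im (- z) = - Im z. Proof. by case: z. Qed.
Lemma ReM z w : Re (z * w) = Re z * Re w - Im z * Im w.
Proof. by case: z; case: w. Qed.
Lemma ImM z w : Im (z * w) = Re z * Im w + Im z * Re w.
Proof. by case: z; case: w. Qed.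
Definition ReImE := (ReD, ImD, ReN, ImN, ReM, ImM).

(** Tested with [u] the conjugate of [z] divided by its modulus. It turns a bound on a modulus into
    bounds on real quantities, to which monotonicity and real integration apply. *)
Lemma normc_dual z B : 0 <= B -> (forall u, normc u <= 1 -> Re (u * z) <= B) ->
  normc z <= B.
Proof.
move=> B0 zB; have [->|z0] := eqVneq (normc z) 0; first by [].
have z1 : 0 < normc z by rewrite lt_neqAle eq_sym z0 normc_ge0.
have := zB (((normc z)^-1)%:C * (Re z -i* Im z)).
rewrite normcM normc_real (normcE (_ -i* _)) /= sqrrN -normcE ger0_norm ?invr_ge0 ?normc_ge0//.
rewrite mulVf// lexx => /(_ isT); rewrite !ReImE /=.
rewrite !mul0r subr0 addr0 mulrN mulNr opprK -!mulrA -mulrDr -!expr2 -sqr_normcE.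
by rewrite expr2 mulKf.
Qed.

Definition cexp z : R[i] := (expR (Re z))%:C * expi (Im z).

Lemma cexp0 : cexp 0 = 1.
Proof. by rewrite /cexp /expi /= expR0 sin0 cos0 mul1r. Qed.

Lemma cexpD z w : cexp (z + w) = cexp z * cexp w.
Proof.
apply: complex_eq; rewrite /cexp !ReImE /expi /= expRD ?cosD ?sinD; ring.
Qed.

Lemma normc_cexp z : normc (cexp z) = expR (Re z).
Proof.
rewrite normcM normc_real ger0_norm ?expR_ge0// normcE /= cos2Dsin2 sqrtr1 mulr1//.
Qed.

Lemma cexp_real x : cexp x%:C = (expR x)%:C.
Proof. by rewrite /cexp /expi /= sin0 cos0 mulr1. Qed.

Lemma cexp_imag x : cexp (0 +i* x) = expi x.
Proof. by rewrite /cexp /= expR0 mul1r. Qed.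



Lemma cexpX z n : cexp z ^+ n = cexp (n%:R * z).
Proof.
elim: n => [|n IH]; first by rewrite mul0r cexp0.
by rewrite exprS IH -cexpD -natr1 mulrDl mul1r addrC.
Qed.

Definition cexp_rem N z := cexp z - \sum_(n < N) z ^+ n / n`!%:R.

(** A derivative in a real variable is enough: the Taylor remainder is only studied along the
    segment from 0 to [z]. *)
Definition cder (g : R -> R[i]) x (d : R[i]) :=
  is_derive x 1 (fun x => Re (g x)) (Re d) /\ is_derive x 1 (fun x => Im (g x)) (Im d).

Lemma cder_cst c x : cder (fun=> c) x 0.
Proof. by split; exact: is_derive_cst. Qed.

Lemma cderD g h x d e : cder g x d -> cder h x e -> cder (fun x => g x + h x) x (d + e).
Proof.
move=> [g1 g2] [h1 h2]; split.
- rewrite ReD (_ : (fun _ => _) = (fun x => Re (g x)) + (fun x => Re (h x))).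
    exact: is_deriveD.
  by apply/funext => y; rewrite ReD.
- rewrite ImD (_ : (fun _ => _) = (fun x => Im (g x)) + (fun x => Im (h x))).
    exact: is_deriveD.
  by apply/funext => y; rewrite ImD.
Qed.

Lemma cderMl c g x d : cder g x d -> cder (fun x => c * g x) x (c * d).
Proof.
move=> [g1 g2]; split.
- rewrite ReM (_ : (fun _ => _) = (Re c) *: (fun x => Re (g x)) - (Im c) *: (fun x => Im (g x))).
    exact: is_deriveB.
  by apply/funext => y; rewrite ReM.
- rewrite ImM (_ : (fun _ => _) = (Re c) *: (fun x => Im (g x)) + (Im c) *: (fun x => Re (g x))).
    exact: is_deriveD.
  by apply/funext => y; rewrite ImM.
Qed.

Lemma cder_sum N (g : nat -> R -> R[i]) (d : nat -> R[i]) x :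
  (forall n, cder (g n) x (d n)) ->
  cder (fun x => \sum_(n < N) g n x) x (\sum_(n < N) d n).
Proof.
move=> gd; elim: N => [|N IH].
  under [X in cder X]eq_fun do rewrite big_ord0; rewrite big_ord0; exact: cder_cst.
under [X in cder X]eq_fun do rewrite big_ord_recr; rewrite big_ord_recr/=.
exact: cderD.
Qed.

Lemma cder_scaleX z n x :
  cder (fun s => (s%:C * z) ^+ n.+1 / (n.+1)`!%:R) x (z * ((x%:C * z) ^+ n / n`!%:R)).
Proof.
have X1 : cder (fun s => (s ^+ n.+1)%:C) x (n.+1%:R * x ^+ n)%:C.
  split => /=; last exact: is_derive_cst.
  rewrite [X in is_derive _ _ X](_ : _ = (@id R) ^+ n.+1); last first.
    by apply/funext => s; rewrite exprfctE.
  apply: (is_derive_eq (is_deriveX n.+1 (is_derive_id x (1 : R)))).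
  by rewrite /GRing.scale/= mulr1.
have := cderMl (z ^+ n.+1 / (n.+1)`!%:R) X1.
congr cder.
  by apply/funext => s; rewrite exprMn rmorphXn/= mulrC mulrA.
rewrite factS natrM invfM exprMn rmorphM rmorph_nat rmorphXn/= exprS.
have n0 : (n.+1%:R : R[i]) != 0 by rewrite pnatr_eq0.
have aux (K : fieldType) (y y' p q X : K) : p != 0 ->
    y * y' * (p^-1 * q) * (p * X) = y * (X * y' * q) by move=> p0; field.
exact: aux.
Qed.

Lemma is_derive_mulr (c x : R) : is_derive x 1 (fun s => s * c) c.
Proof.
rewrite [X in is_derive _ _ X](_ : _ = c *: (@id R)); last first.
  by apply/funext => s; rewrite /= mulrC.
by apply: (is_derive_eq (is_deriveZ c (is_derive_id x (1 : R)))); rewrite /GRing.scale/= mulr1.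
Qed.

Lemma cder_cexp z x : cder (fun s => cexp (s%:C * z)) x (z * cexp (x%:C * z)).
Proof.
have De : is_derive x 1 (fun s => expR (s * Re z)) (Re z * expR (x * Re z)).
  by apply: (is_derive_eq (is_derive1_comp (is_derive_expR _) (is_derive_mulr _ x))); rewrite mulrC.
have Dc : is_derive x 1 (fun s => cos (s * Im z)) (- Im z * sin (x * Im z)).
  by apply: (is_derive_eq (is_derive1_comp (is_derive_cos _) (is_derive_mulr _ x))); ring.
have Ds : is_derive x 1 (fun s => sin (s * Im z)) (Im z * cos (x * Im z)).
  by apply: (is_derive_eq (is_derive1_comp (is_derive_sin _) (is_derive_mulr _ x))); ring.
split; rewrite /cexp /expi.
- rewrite [X in is_derive _ _ X](_ : _ = (fun s => expR (s * Re z)) * (fun s => cos (s * Im z))); last first.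
    by apply/funext => s; rewrite !ReImE /= !mul0r !subr0 addr0.
  apply: (is_derive_eq (is_deriveM De Dc)).
  rewrite !ReImE /= !mul0r !subr0 !addr0 /GRing.scale/=; ring.
- rewrite [X in is_derive _ _ X](_ : _ = (fun s => expR (s * Re z)) * (fun s => sin (s * Im z))); last first.
    by apply/funext => s; rewrite !ReImE /= !mul0r !subr0 !addr0.
  apply: (is_derive_eq (is_deriveM De Ds)).
  rewrite !ReImE /= !mul0r !subr0 !addr0 /GRing.scale/=; ring.
Qed.

(** The order of the remainder drops by one under differentiation, which drives the induction in
    [cexp_taylor]. *)
Lemma cder_cexp_rem N z x :
  cder (fun s => cexp_rem N.+1 (s%:C * z)) x (z * cexp_rem N (x%:C * z)).
Proof.
rewrite /cexp_rem mulrBr; apply: cderD; first exact: cder_cexp.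
under [X in cder X]eq_fun do rewrite big_ord_recl expr0 fact0 invr1 mulr1 opprD.
rewrite -[X in cder _ _ X]add0r; apply: cderD; first exact: cder_cst.
under [X in cder X]eq_fun do rewrite -mulN1r.
rewrite mulr_sumr -[X in cder _ _ X]mulN1r; apply: (@cderMl (-1) (fun s => \sum_(i < N) (s%:C * z) ^+ lift ord0 i / (lift ord0 i)`!%:R)).
by apply: (@cder_sum N (fun n s => (s%:C * z) ^+ n.+1 / (n.+1)`!%:R) (fun n => z * ((x%:C * z) ^+ n / n`!%:R))) => n; exact: cder_scaleX.
Qed.

(* The free parameter [l] is taken to be 2 for convergence of the series and
   [1 / |h|] to get a bound of order [|h| ^ N] without polynomial factors. *)
Lemma cexp_taylor N l z : 1 <= l ->
  normc (cexp_rem N z) <= (l ^+ N)^-1 * expR (l * normc z).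
Proof.
move=> l1; have l0 : 0 < l by lra.
elim: N z => [|N IH] z.
  rewrite /cexp_rem big_ord0 subr0 normc_cexp expr0 invr1 mul1r ler_expR.
  have := ler_Re_normc z; have := normc_ge0 z; have := ler_norm (Re z); nra.
have lN0 n : 0 < (l ^+ n)^-1 by rewrite invr_gt0 exprn_gt0.
apply: normc_dual; first by rewrite mulr_ge0 ?expR_ge0// ltW.
move=> u u1.
(* [g] is a real projection of the remainder along the segment from 0 to [z], and [h] is the claimed
   majorant. The induction hypothesis bounds the derivative of [g] by that of [h], so [h - g] is
   nondecreasing; at 0 the remainder vanishes and [h] is positive. *)
pose g (s : R) : R := Re (u * cexp_rem N.+1 (s%:C * z)).
pose h (s : R) : R := (l ^+ N.+1)^-1 * expR (s * (l * normc z)).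
have Dg s : is_derive s 1 g (Re (u * (z * cexp_rem N (s%:C * z)))).
  by have [] := cderMl u (cder_cexp_rem N z s).
have Dh s : is_derive s 1 h ((l ^+ N)^-1 * normc z * expR (s * (l * normc z))).
  rewrite /h.
  have De : is_derive s 1 (fun s => expR (s * (l * normc z))) ((l * normc z) * expR (s * (l * normc z))).
    by apply: (is_derive_eq (is_derive1_comp (is_derive_expR _) (is_derive_mulr _ s))); rewrite mulrC.
  rewrite [X in is_derive _ _ X](_ : _ = (l ^+ N.+1)^-1 *: (fun s => expR (s * (l * normc z)))) //.
  apply: (is_derive_eq (is_deriveZ _ De)); rewrite /GRing.scale/= exprS invfM; field.
  by rewrite expf_neq0 gt_eqF.
have D s : is_derive s 1 (h - g) ((l ^+ N)^-1 * normc z * expR (s * (l * normc z)) - Re (u * (z * cexp_rem N (s%:C * z)))).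
  exact: is_deriveB.
have : (h - g) 0 <= (h - g) 1.
  apply: (@ger0_derive1_ndecr R _ 0 1) => //.
  - move=> s; rewrite in_itv/= => /andP[s0 s1]; rewrite derive1E.
    have -> := @derive_val _ _ _ _ _ _ _ (D s).
    rewrite subr_ge0; apply: (le_trans (ler_norm _)); apply: (le_trans (ler_Re_normc _)).
    rewrite !normcM; have := IH (s%:C * z); rewrite normcM normc_real gtr0_norm//.
    rewrite (_ : l * (s * normc z) = s * (l * normc z)); last by ring.
    set A := normc (cexp_rem _ _); set B := expR _ => AB.
    rewrite -mulrA (mulrCA (l ^- N)) (le_trans (_ : _ <= 1 * (normc z * A))) ?ler_wpM2r ?mulr_ge0 ?normc_ge0//.
    by rewrite mul1r ler_wpM2l ?normc_ge0.
  - apply: derivable_within_continuous => s _; by case: (D s).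
rewrite !fctE /g /h !mul1r mul0r expR0 mulr1.
have -> : cexp_rem N.+1 (0%:C * z) = 0.
  rewrite mul0r /cexp_rem cexp0 big_ord_recl expr0 fact0 invr1 mulr1 big1 ?addr0 ?subrr// => i _.
  by rewrite expr0n mul0r.
rewrite mulr0 /= subr0 => H.
have := lN0 N.+1; lra.
Qed.

End Complex.

(** * Maximum principle and Phragmen-Lindelof *)

Section Jets.
Context {R : realType}.
Implicit Types (f g : R[i] -> R[i]) (z w u h : R[i]) (x y s t : R).

(** With [l = 1 / |h|] in [cexp_taylor] the exponent becomes [|x|], free of [h], so that a Gaussian
    weight absorbs it uniformly in [jet2_laplace]. *)
Lemma cexp_rem_scale N x h : normc h <= 1 ->
  normc (cexp_rem N.+1 (x%:C * h)) <= normc h ^+ N.+1 * expR `|x|.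
Proof.
move=> h1; have [h0|h0] := eqVneq (normc h) 0.
  rewrite (normc_eq0 h0) mulr0 normc0 /cexp_rem cexp0 big_ord_recl expr0 fact0 invr1 mulr1.
  rewrite big1 ?addr0 ?subrr ?normc0 ?mulr_ge0 ?expR_ge0 ?exprn_ge0//.
  by move=> i _; rewrite expr0n mul0r.
have hp : 0 < normc h by rewrite lt_neqAle eq_sym h0 normc_ge0.
have := @cexp_taylor R N.+1 (normc h)^-1 (x%:C * h).
rewrite invf_ge1// h1 => /(_ isT); rewrite exprVn invrK normcM normc_real.
by rewrite mulrCA mulVf// mulr1.
Qed.

(** The radius is kept at most 1 so that a higher power of [|h|] is dominated by a lower one with
    the same constant, as in [bigOW]. *)
Definition bigO n (r : R[i] -> R[i]) := exists M d : R,
  [/\ 0 <= M, 0 < d, d <= 1 & forall h, normc h <= d -> normc (r h) <= M * normc h ^+ n].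

Lemma bigO_cst c : bigO 0 (fun=> c).
Proof.
exists (normc c), 1; split; rewrite ?normc_ge0 ?ltr01 ?lexx//.
by move=> h _; rewrite expr0 mulr1.
Qed.

Lemma bigO_X n : bigO n (fun h => h ^+ n).
Proof.
exists 1, 1; split; rewrite ?ltr01 ?lexx ?ler01//.
by move=> h _; rewrite mul1r normcX.
Qed.

Lemma bigOD n r1 r2 : bigO n r1 -> bigO n r2 -> bigO n (fun h => r1 h + r2 h).
Proof.
move=> [M1 [d1 [M10 d10 d11 H1]]] [M2 [d2 [M20 d20 d21 H2]]].
exists (M1 + M2), (Num.min d1 d2); split; rewrite ?addr_ge0 ?lt_min ?d10 ?ge_min ?d11//.
move=> h; rewrite le_min => /andP[hd1 hd2].
by rewrite (le_trans (le_normcD _ _))// mulrDl lerD ?H1 ?H2.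
Qed.

Lemma bigOM n1 n2 r1 r2 : bigO n1 r1 -> bigO n2 r2 -> bigO (n1 + n2) (fun h => r1 h * r2 h).
Proof.
move=> [M1 [d1 [M10 d10 d11 H1]]] [M2 [d2 [M20 d20 d21 H2]]].
exists (M1 * M2), (Num.min d1 d2); split; rewrite ?mulr_ge0 ?lt_min ?d10 ?ge_min ?d11//.
move=> h; rewrite le_min => /andP[hd1 hd2].
by rewrite normcM exprD mulrACA ler_pM ?normc_ge0 ?H1 ?H2.
Qed.

Lemma bigOW m n r : (m <= n)%N -> bigO n r -> bigO m r.
Proof.
move=> mn [M [d [M0 d0 d1 H]]]; exists M, d; split => // h hd.
rewrite (le_trans (H _ hd))// ler_wpM2l// ler_wiXn2l ?normc_ge0//.
exact: le_trans d1.
Qed.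

Lemma bigOMl c n r : bigO n r -> bigO n (fun h => c * r h).
Proof. by move=> H; apply: (bigOM (bigO_cst c) H). Qed.

Lemma bigO_comp n r k : bigO n.+1 r -> bigO 1 k -> bigO n.+1 (fun h => r (k h)).
Proof.
move=> [M1 [d1 [M10 d10 d11 H1]]] [M2 [d2 [M20 d20 d21 H2]]].
have M2p : 0 < M2 + 1 by lra.
(* The second radius keeps [k h] inside the disc where the bound on [r] holds; [M2 + 1] stands in
   for [M2] because it must be a positive divisor. *)
exists (M1 * (M2 + 1) ^+ n.+1), (Num.min d2 (d1 / (M2 + 1))).
split; rewrite ?mulr_ge0 ?exprn_ge0 ?(ltW M2p)// ?lt_min ?d20 ?divr_gt0//.
  by rewrite ge_min d21.
move=> h; rewrite le_min ler_pdivlMr// => /andP[hd1 hd2].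
have := H2 _ hd1; rewrite expr1 => kh.
have kh2 : normc (k h) <= (M2 + 1) * normc h by have := normc_ge0 h; nra.
rewrite (le_trans (H1 _ _))//.
  by rewrite (le_trans kh2)// mulrC.
by rewrite -mulrA -exprMn ler_wpM2l// ler_pXn2r ?nnegrE ?mulr_ge0 ?normc_ge0// ltW.
Qed.

(* Complex differentiability in the form of a second-order expansion: the
   quadratic term cancels in averages over [z + h, z + ih, z - h, z - ih]. *)
Definition jet2 f z := exists c1 c2 : R[i],
  bigO 3 (fun h => f (z + h) - f z - c1 * h - c2 * h ^+ 2).

Lemma jet2_lip f z : jet2 f z -> bigO 1 (fun h => f (z + h) - f z).
Proof.
move=> [c1 [c2 H]].
have -> : (fun h => f (z + h) - f z) =
  (fun h => c1 * h ^+ 1 + (c2 * h ^+ 2 + (f (z + h) - f z - c1 * h - c2 * h ^+ 2))).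
  by apply/funext => h; ring.
apply: bigOD; first exact: (bigOMl c1 (bigO_X 1)).
apply: bigOD; first exact: (bigOMl _ (bigOW (isT : (1 <= 2)%N) (bigO_X 2))).
exact: bigOW H.
Qed.

Lemma jet2_cst c z : jet2 (fun=> c) z.
Proof.
exists 0, 0; exists 0, 1; split; rewrite ?ltr01 ?lexx// => h _.
by rewrite !mul0r subrr !subr0 normc0.
Qed.

Lemma jet2_id z : jet2 (fun w => w) z.
Proof.
exists 1, 0; exists 0, 1; split; rewrite ?ltr01 ?lexx// => h _.
by rewrite (_ : _ - _ = 0) ?normc0 ?mul0r//; ring.
Qed.

Lemma jet2D f g z : jet2 f z -> jet2 g z -> jet2 (fun w => f w + g w) z.
Proof.
move=> [a1 [a2 Hf]] [b1 [b2 Hg]]; exists (a1 + b1), (a2 + b2).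
have := bigOD Hf Hg; congr bigO; apply/funext => h; ring.
Qed.

Lemma jet2M f g z : jet2 f z -> jet2 g z -> jet2 (fun w => f w * g w) z.
Proof.
move=> [a1 [a2 Hf]] [b1 [b2 Hg]].
exists (f z * b1 + a1 * g z), (f z * b2 + a1 * b1 + a2 * g z).
have := jet2_lip (ex_intro _ b1 (ex_intro _ b2 Hg)) => Lg.
(* These are the terms of order at least 3 in the product of the two expansions; [h4] pairs the
   remainder of [f] with the whole increment of [g]. *)
have h1 := bigOMl (a1 * b2 + a2 * b1) (bigO_X 3).
have h2 := bigOMl (a2 * b2) (bigOW (isT : (3 <= 4)%N) (bigO_X 4)).
have h3 := bigOMl (g z) Hf.
have h4 := bigOW (isT : (3 <= 3 + 1)%N) (bigOM Hf Lg).
have h5 := bigOMl (f z) Hg.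
have h6 := bigOMl a1 (bigOW (isT : (3 <= 1 + 3)%N) (bigOM (bigO_X 1) Hg)).
have h7 := bigOMl a2 (bigOW (isT : (3 <= 2 + 3)%N) (bigOM (bigO_X 2) Hg)).
have := bigOD h1 (bigOD h2 (bigOD h3 (bigOD h4 (bigOD h5 (bigOD h6 h7))))).
congr bigO; apply/funext => h; ring.
Qed.

Lemma jet2Ml c f z : jet2 f z -> jet2 (fun w => c * f w) z.
Proof. exact/jet2M/jet2_cst. Qed.

Lemma jet2_comp f g z : jet2 g (f z) -> jet2 f z -> jet2 (fun w => g (f w)) z.
Proof.
move=> [b1 [b2 Hg]] Jf; have Lf := jet2_lip Jf; move: Jf => [a1 [a2 Hf]].
exists (b1 * a1), (b1 * a2 + b2 * a1 ^+ 2).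
(* For the quadratic term: with D the increment of [f], D^2 - (a1 h)^2 = (D - a1 h)(D + a1 h) is of
   order 2 + 1. *)
have L2 : bigO 2 (fun h => f (z + h) - f z - a1 * h).
  have := bigOD (bigOW (isT : (2 <= 3)%N) Hf) (bigOMl a2 (bigO_X 2)).
  congr bigO; apply/funext => h; ring.
have L1 : bigO 1 (fun h => f (z + h) - f z + a1 * h).
  exact: (bigOD Lf (bigOMl a1 (bigO_X 1))).
have := bigOD (bigO_comp Hg Lf) (bigOD (bigOMl b1 Hf) (bigOMl b2 (bigOM L2 L1))).
congr bigO; apply/funext => h; rewrite (addrC (f z)) subrK; ring.
Qed.

Lemma jet2_cexp z : jet2 cexp z.
Proof.
exists (cexp z), (cexp z / 2).
have H : bigO 3 (fun h => cexp_rem 3 h).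
  exists (expR 1), 1; split; rewrite ?expR_ge0 ?ltr01 ?lexx// => h h1.
  by have := cexp_rem_scale 2 1 h1; rewrite mul1r normr1 mulrC.
have := bigOMl (cexp z) H; congr bigO; apply/funext => h.
rewrite cexpD /cexp_rem !big_ord_recr big_ord0 /= expr0 expr1 !fact0 /= (_ : 2`! = 2)%N// (_ : 1`! = 1)%N//.
by field.
Qed.

Lemma continuous_normc_jet2 f : (forall z, jet2 f z) ->
  continuous (fun p : R * R => normc (f (p.1 +i* p.2))).
Proof.
move=> Jf p; apply/cvgrPdist_le => /= e e0.
have [M [d [M0 d0 d1 H]]] := jet2_lip (Jf (p.1 +i* p.2)).
have M1 : 0 < M + 1 by lra.
have d'0 : 0 < Num.min d (e / (M + 1)) / 2 by rewrite divr_gt0// lt_min d0 divr_gt0.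
near=> q.
have [q1 q2] : ball p (Num.min d (e / (M + 1)) / 2) q by near: q; exists (ball p.1 (Num.min d (e / (M + 1)) / 2), ball p.2 (Num.min d (e / (M + 1)) / 2)) => //=; split; exact: nbhsx_ballx.
pose h : R[i] := (q.1 - p.1) +i* (q.2 - p.2).
have qE : q.1 +i* q.2 = (p.1 +i* p.2) + h by apply: complex_eq; rewrite !ReImE /=; ring.
have hd : normc h <= Num.min d (e / (M + 1)).
  rewrite (le_trans (le_normc_ReIm _))//= [leRHS]splitr lerD//.
    by rewrite distrC ltW.
  by rewrite distrC ltW.
move: (hd); rewrite le_min ler_pdivlMr// => /andP[hd1 hd2].
have := H _ hd1; rewrite -qE expr1 => Hq.
apply: (le_trans (y := normc (f (q.1 +i* q.2) - f (p.1 +i* p.2)))); last first.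
  by rewrite (le_trans Hq)//; have := normc_ge0 h; nra.
set A := f _; set B := f _.
have := le_normcD (B - A) A; have := le_normcD (A - B) B; rewrite !subrK.
rewrite -(normcN (A - B)) opprB => h1 h2.
by rewrite ler_norml; apply/andP; split; lra.
Unshelve. all: by end_near. Qed.

(** It bounds [|w|^2] from below by an expression linear in [w], so that values of [f] at
    neighbouring points can be averaged before any modulus is taken. *)
Lemma Re_conj_le z w : 2 * Re (z^* * w) <= normc z ^+ 2 + normc w ^+ 2.
Proof.
rewrite !sqr_normcE; case: z => a b; case: w => c d /=.
have := sqr_ge0 (a - c); have := sqr_ge0 (b - d); nra.
Qed.

(* Perturbing [|f| ^ 2] by [e x ^ 2] makes it strictly subharmonic, hence
   without interior maximum. *)
Lemma max_modulus_rect f (x0 x1 y0 y1 B : R) :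
  (forall z, jet2 f z) -> 0 <= B -> x0 < x1 -> y0 < y1 ->
  (forall x, x0 <= x <= x1 -> normc (f (x +i* y0)) <= B) ->
  (forall x, x0 <= x <= x1 -> normc (f (x +i* y1)) <= B) ->
  (forall y, y0 <= y <= y1 -> normc (f (x0 +i* y)) <= B) ->
  (forall y, y0 <= y <= y1 -> normc (f (x1 +i* y)) <= B) ->
  forall x y, x0 <= x <= x1 -> y0 <= y <= y1 -> normc (f (x +i* y)) <= B.
Proof.
move=> Jf B0 x01 y01 By0 By1 Bx0 Bx1 x y xx yy.
have xm s : x0 <= s <= x1 -> s ^+ 2 <= x0 ^+ 2 + x1 ^+ 2 by move=> /andP[]; have [] := leP 0 s; nra.
set m := x0 ^+ 2 + x1 ^+ 2 in xm.
have m0 : 0 <= m by rewrite addr_ge0 ?sqr_ge0.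
suff H : forall e, 0 < e -> normc (f (x +i* y)) ^+ 2 <= B ^+ 2 + e * m.
  rewrite -(ler_pXn2r (n := 2)) ?nnegrE ?normc_ge0//.
  apply/ler_addgt0Pr => e e0; apply: (le_trans (H (e / (m + 1)) _)).
    by rewrite divr_gt0//; lra.
  rewrite lerD2l mulrAC ler_pdivrMr; nra.
move=> e e0.
pose v (p : R * R) : R := normc (f (p.1 +i* p.2)) ^+ 2 + e * p.1 ^+ 2.
pose A := `[x0, x1]%classic `*` `[y0, y1]%classic : set (R * R).
have inA p : (p \in A) = (x0 <= p.1 <= x1) && (y0 <= p.2 <= y1).
  by rewrite /A; apply/idP/idP; rewrite inE /= !in_itv/=; [case=> -> -> | move=> /andP[-> ->]].
have cv : continuous v.
  move=> p; apply: cvgD; last first.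
    apply: cvgMr; apply: (cvg_comp (fun p : R * R => p.1) (fun x => x ^+ 2)); last exact: sqr_continuous.
    exact: cvg_fst.
  apply: (cvg_comp (fun p : R * R => normc (f (p.1 +i* p.2))) (fun x => x ^+ 2)); last exact: sqr_continuous.
  exact: continuous_normc_jet2.
have [c cA cmax] : exists2 c, c \in A & forall p, p \in A -> v p <= v c.
  apply: compact_EVT_max.
  - exists (x, y); move: (inA (x, y)); rewrite xx yy /= => /idP; by rewrite inE.
  - by apply: compact_setX; exact: segment_compact.
  - exact: continuous_subspaceT.
suff vc : v c <= B ^+ 2 + e * m.
  have := cmax (x, y); rewrite inA xx yy => /(_ isT) /le_trans/(_ vc).
  by apply: le_trans; rewrite /v/= lerDl mulr_ge0 ?sqr_ge0// ltW.
move: (cA); rewrite inA => /andP[cx cy].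
have [bd|] := boolP [|| c.1 == x0, c.1 == x1, c.2 == y0 | c.2 == y1].
  apply: lerD; last by rewrite ler_wpM2l ?xm ?(ltW e0).
  rewrite ler_pXn2r ?nnegrE ?normc_ge0//.
  by case/or4P: bd => /eqP ->; [apply: Bx0|apply: Bx1|apply: By0|apply: By1].
rewrite !negb_or => /and4P[cx0 cx1 cy0 cy1].
have {cx0 cx1 cx} [cx0 cx1] : x0 < c.1 /\ c.1 < x1.
  by move: cx => /andP[? ?]; rewrite !lt_neqAle [x0 == _]eq_sym cx0 cx1.
have {cy0 cy1 cy} [cy0 cy1] : y0 < c.2 /\ c.2 < y1.
  by move: cy => /andP[? ?]; rewrite !lt_neqAle [y0 == _]eq_sym cy0 cy1.
exfalso.
set z := c.1 +i* c.2.
have [a1 [a2 [M [d [M0 d0 d1 H]]]]] := Jf z.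
(* Adding the inequalities [v <= v c] at the four neighbours will give
   [e * h ^ 2 <= 4 * normc (f z) * M * h ^ 3], while [h <= e / (2 * q)] makes the right side too
   small. The [+ 1] only keeps [q] positive. *)
set q := 4 * normc (f z) * M + 1.
have q0 : 0 < q by rewrite ltr_wpDl// !mulr_ge0 ?normc_ge0.
pose h := Num.min (Num.min d (e / (2 * q))) (Num.min (Num.min (c.1 - x0) (x1 - c.1)) (Num.min (c.2 - y0) (y1 - c.2))).
have h0 : 0 < h by rewrite !lt_min d0 !subr_gt0 cx0 cx1 cy0 cy1 !andbT /= divr_gt0// mulr_gt0.
have : h <= h by [].
rewrite {2}/h !le_min => /andP[/andP[hd he] /andP[/andP[hx0 hx1] /andP[hy0 hy1]]].
have V p : x0 <= p.1 <= x1 -> y0 <= p.2 <= y1 -> v p <= v c.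
  by move=> p1 p2; apply: cmax; rewrite inA p1 p2.
have V1 := V (c.1 + h, c.2); have V2 := V (c.1 - h, c.2).
have V3 := V (c.1, c.2 + h); have V4 := V (c.1, c.2 - h).
rewrite /v /= in V1 V2 V3 V4.
have {}V1 := V1 ltac:(lra) ltac:(lra). have {}V2 := V2 ltac:(lra) ltac:(lra).
have {}V3 := V3 ltac:(lra) ltac:(lra). have {}V4 := V4 ltac:(lra) ltac:(lra).
have E1 : (c.1 + h) +i* c.2 = z + h%:C by apply: complex_eq; rewrite !ReImE /= ?addr0.
have E2 : (c.1 - h) +i* c.2 = z + - h%:C by apply: complex_eq; rewrite !ReImE /= ?oppr0 ?addr0.
have E3 : c.1 +i* (c.2 + h) = z + (0 +i* h) by apply: complex_eq; rewrite !ReImE /= ?addr0.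
have E4 : c.1 +i* (c.2 - h) = z + - (0 +i* h) by apply: complex_eq; rewrite !ReImE /= ?oppr0 ?addr0.
rewrite E1 in V1; rewrite E2 in V2; rewrite E3 in V3; rewrite E4 in V4.
have nh : normc h%:C = h by rewrite normc_real gtr0_norm.
have nih : normc (0 +i* h : R[i]) = h by rewrite normcE /= expr0n add0r sqrtr_sqr gtr0_norm.
have H1 := H h%:C; have H2 := H (- h%:C); have H3 := H (0 +i* h); have H4 := H (- (0 +i* h)).
rewrite ?normcN ?nh ?nih in H1 H2 H3 H4.
have {}H1 := H1 hd; have {}H2 := H2 hd; have {}H3 := H3 hd; have {}H4 := H4 hd.
have isq : (0 +i* h : R[i]) ^+ 2 = - (h%:C ^+ 2).
  by apply: complex_eq; rewrite !expr2 !ReImE /=; ring.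
have S1 := Re_conj_le (f z) (f (z + h%:C)).
have S2 := Re_conj_le (f z) (f (z - h%:C)).
have S3 := Re_conj_le (f z) (f (z + (0 +i* h))).
have S4 := Re_conj_le (f z) (f (z - (0 +i* h))).
set f1 := f (z + h%:C) in V1 H1 S1; set f2 := f (z - h%:C) in V2 H2 S2.
set f3 := f (z + (0 +i* h)) in V3 H3 S3; set f4 := f (z - (0 +i* h)) in V4 H4 S4.
have sumf : f1 + f2 + f3 + f4 - (f z + f z + f z + f z) = (f1 - f z - a1 * h%:C - a2 * h%:C ^+ 2)
  + (f2 - f z - a1 * - h%:C - a2 * (- h%:C) ^+ 2)
  + (f3 - f z - a1 * (0 +i* h) - a2 * (0 +i* h) ^+ 2)
  + (f4 - f z - a1 * - (0 +i* h) - a2 * (- (0 +i* h)) ^+ 2).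
  by rewrite !sqrrN isq; ring.
have Hs : normc (f1 + f2 + f3 + f4 - (f z + f z + f z + f z)) <= 4 * (M * h ^+ 3).
  rewrite sumf.
  set g1 := _ - _ in H1 *; set g2 := _ - _ in H2 *; set g3 := _ - _ in H3 *; set g4 := _ - _ in H4 *.
  have := le_normcD (g1 + g2 + g3) g4; have := le_normcD (g1 + g2) g3; have := le_normcD g1 g2.
  lra.
have : - (normc (f z) * (4 * (M * h ^+ 3))) <= Re ((f z)^* * (f1 + f2 + f3 + f4 - (f z + f z + f z + f z))).
  rewrite lerNl (le_trans (ler_norm _))// normrN (le_trans (ler_Re_normc _))// normcM.
  rewrite (_ : normc (f z)^* = normc (f z)); last by rewrite !normcE; case: (f z) => ? ? /=; rewrite sqrrN.
  by rewrite ler_wpM2l ?normc_ge0.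
have -> : Re ((f z)^* * (f1 + f2 + f3 + f4 - (f z + f z + f z + f z))) =
   Re ((f z)^* * f1) + Re ((f z)^* * f2) + Re ((f z)^* * f3) + Re ((f z)^* * f4) - 4 * normc (f z) ^+ 2.
  have RE (w a b c' d' : R[i]) : Re (w^* * (a + b + c' + d' - (w + w + w + w))) =
      Re (w^* * a) + Re (w^* * b) + Re (w^* * c') + Re (w^* * d') - 4 * normc w ^+ 2.
    by rewrite sqr_normcE !ReImE; case: w => w1 w2 /=; ring.
  exact: RE.
rewrite -/z in V1 V2 V3 V4 => HR.
have key : e * h ^+ 2 <= q * h ^+ 3.
  have := exprn_gt0 3 h0; rewrite /q; nra.
have : e <= q * h by rewrite -(ler_pM2r (exprn_gt0 2 h0)) (le_trans key)// -mulrA -exprS.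
rewrite ler_pdivlMr ?mulr_gt0// in he; nra.
Qed.

End Jets.

(** * Phragmen-Lindelof in logarithmic coordinates *)

Section PL.
Context {R : realType}.
Implicit Types (x y : R).

Lemma cexp_mulr_ReIm (r x y : R) :
  Re (cexp (r%:C * (x +i* y))) = expR (r * x) * cos (r * y) /\
  Im (cexp (r%:C * (x +i* y))) = expR (r * x) * sin (r * y).
Proof.
have -> : r%:C * (x +i* y) = (r * x) +i* (r * y).
  by apply: complex_eq; rewrite !ReImE /=; ring.
by rewrite /cexp /expi !ReImE /=; split; ring.
Qed.

(** The limit d -> 0: if [A] exceeded the bound, taking for d half the relative gap contradicts 1 -
    d <= exp (- d). In [phragmen_lindelof], d pays for every perturbation. *)
Lemma ler_mul_expR (A B s : R) : 0 <= B ->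
  (forall d, 0 < d -> A <= B * expR (s + d)) -> A <= B * expR s.
Proof.
move=> B0 H; have [A0|A0] := leP A 0; first by rewrite (le_trans A0)// mulr_ge0 ?expR_ge0.
rewrite leNgt; apply/negP => AB.
pose d := (A - B * expR s) / (2 * A).
have d0 : 0 < d by rewrite divr_gt0 ?subr_gt0 ?mulr_gt0.
have Hd := H _ d0; rewrite expRD mulrA in Hd.
have e1 : 1 - d <= expR (- d) by exact: expR_ge1Dx.
have e2 : A * expR (- d) <= B * expR s.
  by rewrite -[leRHS]mulr1 -(expRxMexpNx_1 d) mulrA ler_wpM2r ?expR_ge0.
have e3 : A * d = (A - B * expR s) / 2 by rewrite /d; field; rewrite gt_eqF.
nra.
Qed.

(* In the coordinate [z = x + iy], [t = exp (z + i pi / 4)], the growth of [F]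
   is killed by [exp (- e exp (rho z))], where [2 < rho < pi / (2 al)]. *)
Lemma phragmen_lindelof (F : R[i] -> R[i]) (a K : R) :
  (forall z, jet2 F z) -> 0 < a -> a < 1 -> 0 <= K ->
  (forall x y, normc (F (cexp (x +i* (pi / 4 + y)))) <=
    K * expR (expR (2 * x) * ((1 - a * `|sin (2 * y)|) / (1 + a)))) ->
  forall x y, `|y| <= pi / 4 -> normc (F (cexp (x +i* (pi / 4 + y)))) <=
    K * expR (Num.sqrt ((1 - a) / (1 + a)) * expR (2 * x)).
Proof.
move=> JF a0 a1 K0 HF x y yb.
have pi0 : 0 < pi :> R := pi_gt0 R.
have a1D : 0 < 1 + a by lra.
set b := Num.sqrt _.
have b0 : 0 <= b by exact: sqrtr_ge0.
have asq : 1 - a ^+ 2 = (1 - a) * (1 + a) by ring.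
(* Here [b] is already the square root of (1 - a) / (1 + a). This is the exact balance on the rays:
   where |sin 2y| = a the bound on [F] has exponent (1 - a^2) / (1 + a) = 1 - a, and [b * cos (2 y)]
   has the same value. *)
have bc : b * Num.sqrt (1 - a ^+ 2) = 1 - a.
  rewrite -sqrtrM; last by rewrite divr_ge0; lra.
  have -> : (1 - a) / (1 + a) * (1 - a ^+ 2) = (1 - a) ^+ 2.
    by rewrite asq; field; rewrite gt_eqF.
  by rewrite sqrtr_sqr ger0_norm//; lra.
have c1 : Num.sqrt (1 - a ^+ 2) <= 1.
  by rewrite -[leRHS]sqrtr1 ler_wsqrtr//; have := sqr_ge0 a; lra.
have c0 : 0 < Num.sqrt (1 - a ^+ 2) by rewrite sqrtr_gt0; nra.
have ab : 1 - a <= b by nra.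
have am : -1 <= a <= 1 by lra.
pose al := asin a / 2.
have sal : sin (2 * al) = a by rewrite /al mulrC divfK ?asinK// in_itv.
have cal : cos (2 * al) = Num.sqrt (1 - a ^+ 2) by rewrite /al mulrC divfK ?cos_asin.
have al4 : al < pi / 4.
  have : asin a < pi / 2 by apply: asin_ltpi2; lra.
  by rewrite /al; lra.
have al0 : 0 < al.
  rewrite ltNge; apply/negP => al0.
  have : sin (2 * al) <= 0.
    rewrite -oppr_ge0 -sinN sin_ge0_pi//.
    have : - (pi / 2) <= asin a by exact: asin_geNpi2.
    by rewrite /al in al0 *; lra.
  by rewrite sal; lra.
clearbody al.
(* From the rays outwards |sin 2s| >= a lowers the given exponent to 1 - a <= [b]. This settles the
   points outside the inner sector and also bounds [F] on its two sides. *)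
have Fout t s : al <= `|s| <= pi / 4 -> normc (F (cexp (t +i* (pi / 4 + s)))) <=
    K * expR (expR (2 * t) * (1 - a)).
  move=> /andP[s1 s2]; apply: (le_trans (HF t s)).
  rewrite ler_wpM2l// ler_expR ler_wpM2l ?expR_ge0// ler_pdivrMr//.
  have sE : a <= `|sin (2 * s)|.
    have sE1 : sin (2 * `|s|) <= `|sin (2 * s)|.
      have [s0|s0] := ger0P s; first exact: ler_norm.
      by rewrite mulrN sinN -normrN ler_norm.
    rewrite (le_trans _ sE1)// -[leLHS]sal le_eqVlt.
    have [->|ne] := eqVneq al `|s|; first by rewrite eqxx.
    apply/orP; right; rewrite ltr_sin ?in_itv/=; last 2 first.
    - by apply/andP; split; lra.
    - by apply/andP; split; lra.
    - by rewrite ltr_pM2l// lt_neqAle ne.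
  nra.
have [y1|y1] := leP al `|y|.
  apply: (le_trans (Fout x y _)); first by rewrite y1 yb.
  by rewrite ler_wpM2l// ler_expR mulrC ler_wpM2r ?expR_ge0.
(* The midpoint of 2 and pi / (2 al). From [rho > 2] the damping outgrows [F], and from
   [rho * al < pi / 2] the cosine of [rho * s] stays positive for [|s| <= al]. *)
pose rho := 1 + pi / (4 * al).
have rho2 : 2 < rho.
  have al40 : 0 < 4 * al by lra.
  have : 1 < pi / (4 * al) by rewrite (ltr_pdivlMr _ _ al40); lra.
  by rewrite /rho; lra.
have rhoal : rho * al = al + pi / 4 by rewrite /rho; field; rewrite gt_eqF.
have crho s : `|s| <= al -> cos (rho * al) <= cos (rho * s).
  move=> s1; have -> : cos (rho * s) = cos (rho * `|s|).
    by have [s0|s0] := ger0P s; rewrite ?mulrN ?cosN.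
  have [->//|ne] := eqVneq al `|s|.
  apply: ltW; rewrite ltr_cos ?in_itv/=.
  - by rewrite ltr_pM2l ?(lt_le_trans _ (ltW rho2))// lt_neqAle eq_sym ne.
  - have := normr_ge0 s => s0; apply/andP; split; first by nra.
    have : rho * `|s| <= rho * al by rewrite ler_wpM2l//; lra.
    by rewrite rhoal; lra.
  - by apply/andP; split; rewrite ?rhoal; lra.
have crho0 : 0 < cos (rho * al) by rewrite rhoal; apply: cos_gt0_pihalf; lra.
have c2 s : `|s| <= al -> 0 <= cos (2 * s).
  by rewrite ler_norml => s1; apply: cos_ge0_pihalf; lra.
apply: ler_mul_expR => // d d0.
(* Scaled so that undoing the damping at the point [x] costs at most d / 2 in the exponent. *)
pose e := d / 2 / expR (rho * x).
have e0 : 0 < e by rewrite !divr_gt0 ?expR_gt0.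
(* As t^2 = i exp (2 z), the term [(- b)%:C * cexp (2%:C * z)] equals i sqrt((1 - a) / (1 + a)) t^2,
   the exponent that balances the bounds on the rays. *)
pose Phi (z : R[i]) := F (cexp (z + (0 +i* (pi / 4)))) *
  cexp ((- b)%:C * cexp (2%:C * z) + (- e)%:C * cexp (rho%:C * z)).
have JPhi z : jet2 Phi z.
  apply: jet2M.
    apply: (@jet2_comp _ (fun z => cexp (z + (0 +i* (pi / 4)))) F) => //.
    apply: (@jet2_comp _ (fun z => z + (0 +i* (pi / 4))) cexp); first exact: jet2_cexp.
    by apply: jet2D; [exact: jet2_id|exact: jet2_cst].
  apply: (@jet2_comp _ (fun z => (- b)%:C * cexp (2%:C * z) + (- e)%:C * cexp (rho%:C * z)) cexp).
    exact: jet2_cexp.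
  apply: jet2D; apply: jet2Ml.
    by apply: (@jet2_comp _ (fun z => 2%:C * z) cexp); [exact: jet2_cexp|apply: jet2Ml; exact: jet2_id].
  by apply: (@jet2_comp _ (fun z => rho%:C * z) cexp); [exact: jet2_cexp|apply: jet2Ml; exact: jet2_id].
have PhiE t s : normc (Phi (t +i* s)) = normc (F (cexp (t +i* (pi / 4 + s)))) *
    expR (- (b * (expR (2 * t) * cos (2 * s))) - e * (expR (rho * t) * cos (rho * s))).
  rewrite /Phi normcM normc_cexp; congr (normc (F (cexp _)) * expR _).
    by apply: complex_eq; rewrite !ReImE /=; ring.
  have Rr (r : R) (u : R[i]) : Re ((- r)%:C * u) = - (r * Re u).
    by rewrite ReM /=; ring.
  by rewrite ReD !Rr !(cexp_mulr_ReIm _ _ _).1.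
(* At [x0] the growth exp (2 x0) of the exponent is at most d / 2, the other half of the allowance;
   at [x1] the damping exceeds the growth. The minimum and maximum with [x - 1] and [x + 1] ensure
   that [x] lies strictly between. *)
pose x0 := Num.min (ln (d / 2) / 2) (x - 1).
pose x1 := Num.max (ln ((e * cos (rho * al))^-1) / (rho - 2)) (x + 1).
have x0x : x0 < x by rewrite gt_min; apply/orP; right; lra.
have xx1 : x < x1 by rewrite lt_max; apply/orP; right; lra.
have ex0 : expR (2 * x0) <= d / 2.
  rewrite -[leRHS]lnK ?posrE ?divr_gt0// ler_expR.
  have : x0 <= ln (d / 2) / 2 by rewrite ge_min lexx.
  lra.
have ex1 : expR (2 * x1) <= e * (expR (rho * x1) * cos (rho * al)).
  have -> : expR (rho * x1) = expR ((rho - 2) * x1) * expR (2 * x1).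
    by rewrite -expRD; congr expR; ring.
  have : (e * cos (rho * al))^-1 <= expR ((rho - 2) * x1).
    have w0 : 0 < (e * cos (rho * al))^-1 by rewrite invr_gt0 mulr_gt0.
    have : ln ((e * cos (rho * al))^-1) / (rho - 2) <= x1 by rewrite le_max lexx.
    have rho20 : 0 < rho - 2 by lra.
    rewrite (ler_pdivrMr _ _ rho20) => lx.
    by rewrite -(lnK (x := (e * cos (rho * al))^-1)) ?posrE// ler_expR (mulrC _ x1).
  rewrite -(ler_pM2l (mulr_gt0 e0 crho0)) divff ?(lt0r_neq0 (mulr_gt0 e0 crho0))//.
  have := expR_gt0 (2 * x1); set E2 := expR _; set Er := expR _.
  move=> E20 H1; have := ler_wpM2r (ltW E20) H1; lra.
pose B := K * expR (expR (2 * x0)).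
have B0 : 0 <= B by rewrite mulr_ge0 ?expR_ge0.
have KB : K <= B.
  by rewrite -[leLHS]mulr1 ler_wpM2l// -[leLHS]expR0 ler_expR expR_ge0.
have side t s : `|s| = al -> normc (Phi (t +i* s)) <= B.
  move=> sE; rewrite PhiE (le_trans _ KB)//.
  have cs : cos (2 * s) = Num.sqrt (1 - a ^+ 2).
    by rewrite -cal -sE; have [s0|s0] := ger0P s; rewrite ?mulrN ?cosN.
  have := Fout t s; rewrite sE lexx (ltW al4) => /(_ isT) Fs.
  apply: (le_trans (ler_wpM2r (expR_ge0 _) Fs)).
  rewrite -mulrA -expRD -[leRHS]mulr1 ler_wpM2l// -[leRHS]expR0 ler_expR cs.
  have := crho s; rewrite sE lexx => /(_ isT) cr.
  have : 0 <= e * (expR (rho * t) * cos (rho * s)).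
    by rewrite !mulr_ge0 ?expR_ge0 ?(ltW e0)//; lra.
  have : b * (expR (2 * t) * Num.sqrt (1 - a ^+ 2)) = expR (2 * t) * (1 - a) by rewrite -bc; ring.
  lra.
have Fall t s : normc (F (cexp (t +i* (pi / 4 + s)))) <= K * expR (expR (2 * t)).
  apply: (le_trans (HF t s)); rewrite ler_wpM2l// ler_expR -[leRHS]mulr1 ler_wpM2l ?expR_ge0//.
  rewrite ler_pdivrMr// mul1r; have := normr_ge0 (sin (2 * s)); nra.
have inner t s : `|s| <= al -> normc (Phi (t +i* s)) <=
    K * expR (expR (2 * t) - e * (expR (rho * t) * cos (rho * al))).
  move=> sa; rewrite PhiE.
  apply: (le_trans (ler_wpM2r (expR_ge0 _) (Fall t s))).
  rewrite -mulrA -expRD ler_wpM2l// ler_expR.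
  have : 0 <= b * (expR (2 * t) * cos (2 * s)) by rewrite !mulr_ge0 ?expR_ge0 ?c2.
  have : e * (expR (rho * t) * cos (rho * al)) <= e * (expR (rho * t) * cos (rho * s)).
    by rewrite !ler_wpM2l ?expR_ge0 ?(ltW e0) ?crho.
  lra.
have : normc (Phi (x +i* y)) <= B.
  apply: (@max_modulus_rect _ Phi x0 x1 (- al) al) => //.
  - exact: lt_trans xx1.
  - lra.
  - by move=> t _; apply: side; rewrite normrN gtr0_norm.
  - by move=> t _; apply: side; rewrite gtr0_norm.
  - move=> s sa; apply: (le_trans (inner _ _ _)); first by rewrite ler_norml.
    rewrite ler_wpM2l// ler_expR lerBlDr lerDl.
    by rewrite (mulr_ge0 (ltW e0)) ?(mulr_ge0 (expR_ge0 _) (ltW crho0)).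
  - move=> s sa; apply: (le_trans (inner _ _ _)); first by rewrite ler_norml.
    rewrite (le_trans _ KB)// -[leRHS]mulr1 ler_wpM2l// -[leRHS]expR0 ler_expR; lra.
  - by rewrite (ltW x0x) (ltW xx1).
  - by rewrite -ler_norml ltW.
rewrite PhiE -ler_pdivlMr ?expR_gt0// -expRN /B -mulrA -expRD => H.
apply: (le_trans H); rewrite ler_wpM2l// ler_expR.
have H1 : e * (expR (rho * x) * cos (rho * y)) <= d / 2.
  rewrite /e mulrA divfK ?gt_eqF ?expR_gt0// -[leRHS]mulr1 ler_wpM2l ?cos_le1// divr_ge0// ltW//.
have H2 : b * (expR (2 * x) * cos (2 * y)) <= b * expR (2 * x).
  by rewrite ler_wpM2l// -[leRHS]mulr1 ler_wpM2l ?expR_ge0 ?cos_le1.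
lra.
Qed.
End PL.

(** * Complex-valued integrals and Gaussian Laplace transforms *)

Section CIntegral.
Context {R : realType}.
Local Notation mu := (@lebesgue_measure R).
Implicit Types (g : R -> R[i]) (h : R -> R).

Definition cmeasurable d (T : measurableType d) (g : T -> R[i]) :=
  measurable_fun setT (fun x => Re (g x)) /\ measurable_fun setT (fun x => Im (g x)).

Lemma cmeasurable_cst d (T : measurableType d) c : @cmeasurable d T (fun=> c).
Proof. by split; exact: measurable_cst. Qed.

Lemma cmeasurableD d (T : measurableType d) (f g : T -> R[i]) :
  cmeasurable f -> cmeasurable g -> cmeasurable (fun x => f x + g x).
Proof.
move=> [f1 f2] [g1 g2]; split.
- by under eq_fun do rewrite ReD; exact: measurable_funD.
- by under eq_fun do rewrite ImD; exact: measurable_funD.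
Qed.

Lemma cmeasurableM d (T : measurableType d) (f g : T -> R[i]) :
  cmeasurable f -> cmeasurable g -> cmeasurable (fun x => f x * g x).
Proof.
move=> [f1 f2] [g1 g2]; split.
- by under eq_fun do rewrite ReM; apply: measurable_funB; exact: measurable_funM.
- by under eq_fun do rewrite ImM; apply: measurable_funD; exact: measurable_funM.
Qed.

Lemma cmeasurable_real d (T : measurableType d) (h : T -> R) :
  measurable_fun setT h -> cmeasurable (fun x => (h x)%:C).
Proof. by move=> mh; split => //=; exact: measurable_cst. Qed.

Lemma cmeasurable_cexp d (T : measurableType d) (g : T -> R[i]) :
  cmeasurable g -> cmeasurable (fun x => cexp (g x)).
Proof.
move=> [g1 g2]; apply: cmeasurableM.
  by apply: cmeasurable_real; exact: measurableT_comp.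
split => /=; apply: measurableT_comp => //.
- by apply: continuous_measurable_fun; exact: (@continuous_cos R).
- by apply: continuous_measurable_fun; exact: (@continuous_sin R).
Qed.

Lemma cintegrable_cmeasurable g : cintegrable g -> cmeasurable g.
Proof.
by move=> [/measurable_int /measurable_EFinP g1 /measurable_int/measurable_EFinP g2].
Qed.

Lemma cintegrable_le g h : cmeasurable g -> mu.-integrable setT (EFin \o h) ->
  (forall x, normc (g x) <= h x) -> cintegrable g.
Proof.
move=> [m1 m2] ih gh; split.
- apply: le_integrable ih => //; first exact/measurable_EFinP.
  move=> x _ /=; rewrite lee_fin (le_trans (ler_Re_normc _))// (le_trans (gh x))//.
  exact: ler_norm.
- apply: le_integrable ih => //; first exact/measurable_EFinP.
  move=> x _ /=; rewrite lee_fin (le_trans (ler_Im_normc _))// (le_trans (gh x))//.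
  exact: ler_norm.
Qed.

Lemma cintegrableD f g : cintegrable f -> cintegrable g ->
  cintegrable (fun x => f x + g x).
Proof.
move=> [f1 f2] [g1 g2]; split.
- apply: eq_integrable (integrableD _ f1 g1) => // x _ /=; by rewrite ReD EFinD.
- apply: eq_integrable (integrableD _ f2 g2) => // x _ /=; by rewrite ImD EFinD.
Qed.

Lemma cintegrableMl c g : cintegrable g -> cintegrable (fun x => c * g x).
Proof.
move=> [g1 g2]; split.
- apply: eq_integrable (integrableB _ (integrableZl _ (Re c) g1) (integrableZl _ (Im c) g2)) => // x _ /=.
  by rewrite ReM EFinB !EFinM.
- apply: eq_integrable (integrableD _ (integrableZl _ (Re c) g2) (integrableZl _ (Im c) g1)) => // x _ /=.
  by rewrite ImM EFinD !EFinM.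
Qed.

Lemma cintegralD f g : cintegrable f -> cintegrable g ->
  cintegral (fun x => f x + g x) = cintegral f + cintegral g.
Proof.
move=> [f1 f2] [g1 g2]; apply: complex_eq; rewrite ?ReD ?ImD /=.
- by under eq_Rintegral do rewrite ReD; exact: RintegralD.
- by under eq_Rintegral do rewrite ImD; exact: RintegralD.
Qed.

Lemma cintegralMl c g : cintegrable g ->
  cintegral (fun x => c * g x) = c * cintegral g.
Proof.
move=> [g1 g2]; apply: complex_eq; rewrite ?ReM ?ImM /=.
- under eq_Rintegral do rewrite ReM.
  by rewrite RintegralB ?RintegralZl//; [exact: (integrableZl _ (Re c) g1)|exact: (integrableZl _ (Im c) g2)].
- under eq_Rintegral do rewrite ImM.
  by rewrite RintegralD ?RintegralZl//; [exact: (integrableZl _ (Re c) g2)|exact: (integrableZl _ (Im c) g1)].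
Qed.

Lemma cintegralB f g : cintegrable f -> cintegrable g ->
  cintegral (fun x => f x - g x) = cintegral f - cintegral g.
Proof.
move=> If Ig; have Ng := cintegrableMl (-1) Ig.
rewrite -[X in _ = _ + X]mulN1r -cintegralMl// -cintegralD//.
by congr cintegral; apply/funext => x; rewrite mulN1r.
Qed.

Lemma cintegrableB f g : cintegrable f -> cintegrable g ->
  cintegrable (fun x => f x - g x).
Proof.
move=> If Ig; have := cintegrableD If (cintegrableMl (-1) Ig).
by congr cintegrable; apply/funext => x; rewrite mulN1r.
Qed.

Lemma cintegrable_sum N (g : nat -> R -> R[i]) : (forall n, cintegrable (g n)) ->
  cintegrable (fun x => \sum_(n < N) g n x).
Proof.
move=> Ig; elim: N => [|N IH].
  under eq_fun do rewrite big_ord0; split; exact: integrable0.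
by under eq_fun do rewrite big_ord_recr; exact: cintegrableD.
Qed.

Lemma cintegral_sum N (g : nat -> R -> R[i]) : (forall n, cintegrable (g n)) ->
  cintegral (fun x => \sum_(n < N) g n x) = \sum_(n < N) cintegral (g n).
Proof.
move=> Ig; elim: N => [|N IH].
  rewrite big_ord0; under eq_fun do rewrite big_ord0.
  by apply: complex_eq => /=; rewrite Rintegral_cst// mul0r.
rewrite big_ord_recr /= -IH -cintegralD//; last exact: cintegrable_sum.
by congr cintegral; apply/funext => x; rewrite big_ord_recr.
Qed.

Lemma normc_cintegral_le g h : cintegrable g -> mu.-integrable setT (EFin \o h) ->
  (forall x, normc (g x) <= h x) -> normc (cintegral g) <= \int[mu]_x h x.
Proof.
move=> Ig ih gh; apply: normc_dual.
  by apply: Rintegral_ge0 => x _; rewrite (le_trans _ (gh x))// normc_ge0.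
move=> u u1; rewrite -cintegralMl//=.
have [Iu _] := cintegrableMl u Ig.
apply: le_Rintegral => // x _.
rewrite (le_trans (ler_norm _))// (le_trans (ler_Re_normc _))// normcM (le_trans _ (gh x))//.
by rewrite ler_piMl// normc_ge0.
Qed.

(** The majorant is a product, so Tonelli makes both components integrable on the plane, and Fubini
    then applies to each of them. *)
Lemma cintegral_fubini (k : R * R -> R[i]) h1 h2 : cmeasurable k ->
  mu.-integrable setT (EFin \o h1) -> mu.-integrable setT (EFin \o h2) ->
  (forall x y, normc (k (x, y)) <= h1 x * h2 y) ->
  cintegrable (fun x => cintegral (fun y => k (x, y))) /\
  cintegral (fun x => cintegral (fun y => k (x, y))) =
  cintegral (fun y => cintegral (fun x => k (x, y))).
Proof.
move=> [k1 k2] ih1 ih2 kh.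
have main (f : R * R -> R) : measurable_fun setT f -> (forall x y, `|f (x, y)| <= h1 x * h2 y) ->
    mu.-integrable setT (fun x => (\int[mu]_y f (x, y))%:E) /\
    \int[mu]_x (\int[mu]_y f (x, y)) = \int[mu]_y (\int[mu]_x f (x, y)).
  move=> mf fh.
  have mfx x : measurable_fun setT (fun y => f (x, y)) by exact: measurableT_comp.
  have mfy y : measurable_fun setT (fun x => f (x, y)) by exact: measurableT_comp.
  have fx x : mu.-integrable setT (fun y => (f (x, y))%:E).
    apply: le_integrable (integrableZl measurableT (h1 x) ih2) => //; first by apply/measurable_EFinP; exact: mfx.
    by move=> y _; rewrite /= lee_fin (le_trans (fh x y))// ler_norm.
  have fy y : mu.-integrable setT (fun x => (f (x, y))%:E).
    apply: le_integrable (integrableZl measurableT (h2 y) ih1) => //; first by apply/measurable_EFinP; exact: mfy.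
    by move=> x _; rewrite /= lee_fin (le_trans (fh x y))// mulrC ler_norm.
  have mF : measurable_fun setT (EFin \o f) by exact/measurable_EFinP.
  have iF : (mu \x mu)%E.-integrable setT (EFin \o f).
    apply/(integrable12ltyP mu mu mF).
    apply: (@le_lt_trans _ _ (\int[mu]_x (`|h1 x|%:E * \int[mu]_y `|h2 y|%:E))%E).
      apply: ge0_le_integral => //.
      - by move=> x _; apply: integral_ge0.
      - have mabs : measurable_fun setT (fun z : R * R => `|(EFin \o f) z|%E) by exact: measurableT_comp.
        exact: (@measurable_fun_fubini_tonelli_F _ _ _ _ R mu _ mabs (fun z => abse_ge0 _)).
      - apply: emeasurable_funM => //; apply/measurable_EFinP.
        by apply: measurableT_comp => //; apply/measurable_EFinP; exact: measurable_int ih1.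
      - move=> x _; rewrite -ge0_integralZl//; last 1 first.
          by apply/measurable_EFinP; apply: measurableT_comp => //; apply/measurable_EFinP; exact: measurable_int ih2.
        apply: ge0_le_integral => //.
        + by apply: measurableT_comp => //; apply/measurable_EFinP; exact: mfx.
        + by apply/measurable_EFinP; apply: measurable_funM => //; apply: measurableT_comp => //; apply/measurable_EFinP; exact: measurable_int ih2.
        + move=> y _; rewrite /= lee_fin (le_trans (fh x y))// -normrM ler_norm//.
    have /integrableP[_ l1] := ih1; have /integrableP[_ l2] := ih2.
    rewrite ge0_integralZr//=; last 2 first.
      by apply/measurable_EFinP; apply: measurableT_comp => //; apply/measurable_EFinP; exact: measurable_int ih1.
      by apply: integral_ge0.
    by rewrite lte_mul_pinfty//; [exact: integral_ge0|rewrite ge0_fin_numE//; exact: integral_ge0].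
  have Ey y : (\int[mu]_x f (x, y))%:E = (\int[mu]_x (f (x, y))%:E)%E.
    by rewrite /Rintegral fineK//; exact: integrable_fin_num.
  have Ex x : (\int[mu]_y f (x, y))%:E = (\int[mu]_y (f (x, y))%:E)%E.
    by rewrite /Rintegral fineK//; exact: integrable_fin_num.
  split.
    by under eq_fun do rewrite Ex; exact: (integrable_fubini_F iF).
  rewrite {1 3}/Rintegral; congr fine.
  under eq_integral do rewrite Ex; under [RHS]eq_integral do rewrite Ey.
  exact: (Fubini iF).
have [r1 r2] := main _ k1 (fun x y => le_trans (ler_Re_normc _) (kh x y)).
have [i1 i2] := main _ k2 (fun x y => le_trans (ler_Im_normc _) (kh x y)).
split; first by split.
exact: complex_eq.
Qed.

(** [shift0] handles nonnegative functions. Both [h + k] and [k] are nonnegative, and subtracting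
    their integrals yields that of [h]. *)
Lemma Rintegral_shift h (k : R -> R) (c : R) : continuous h -> continuous k ->
  mu.-integrable setT (EFin \o k) -> (forall x, `|h x| <= k x) ->
  \int[mu]_x h (x + c) = \int[mu]_x h x.
Proof.
have shift0 (f : R -> R) : continuous f -> (forall x, 0 <= f x) ->
    (\int[mu]_x (f (x + c))%:E = \int[mu]_x (f x)%:E)%E.
  move=> cf f0.
  have dF (x : R) : is_derive x (1 : R) (fun x : R => x + c) (1 : R).
    rewrite -[X in is_derive _ _ _ X]addr0.
    by apply: (is_deriveD (is_derive_id x (1 : R)) (is_derive_cst c x (1 : R))).
  have F' : (fun x : R => x + c)^`()%classic = cst (1 : R).
    by apply/funext => x; rewrite derive1E; exact: derive_val.
  rewrite [RHS](@increasing_ge0_integration_by_substitutionT R (fun x : R => x + c) f) ?F'//.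
  - by apply: eq_integral => x _ /=; rewrite mulr1.
  - by move=> x y xy; rewrite ltrD2r.
  - by move=> ?; exact: cvg_cst.
  - exact: is_cvg_cst.
  - exact: is_cvg_cst.
  - exact: cvg_addrr_Ny.
  - exact: cvg_addrr.
move=> ch ck ik hk.
have k0 x : 0 <= k x by rewrite (le_trans _ (hk x)).
have cs : continuous (fun x : R => x + c) by move=> x; apply: cvgD; [exact: cvg_id|exact: cvg_cst].
have ih : mu.-integrable setT (EFin \o h).
  apply: le_integrable ik => //; first by apply/measurable_EFinP; exact: continuous_measurable_fun.
  by move=> x _; rewrite /= lee_fin (le_trans (hk x))// ler_norm.
have iks : mu.-integrable setT (EFin \o (fun x => k (x + c))).
  have mk : measurable_fun setT (EFin \o (fun x => k (x + c))).
    apply/measurable_EFinP; apply: continuous_measurable_fun => x.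
    by apply: (cvg_comp (fun x => x + c) k); [exact: cs|exact: ck].
  apply/integrableP; split => //.
  under eq_integral do rewrite /= ger0_norm//.
  rewrite shift0//; have /integrableP[_] := ik.
  by under eq_integral do rewrite /= ger0_norm//.
have ihs : mu.-integrable setT (EFin \o (fun x => h (x + c))).
  apply: le_integrable iks => //.
    apply/measurable_EFinP; apply: continuous_measurable_fun => x.
    by apply: (cvg_comp (fun x => x + c) h); [exact: cs|exact: ch].
  by move=> x _; rewrite /= lee_fin (le_trans (hk _))// ler_norm.
have hkE : \int[mu]_x (h (x + c) + k (x + c)) = \int[mu]_x (h x + k x).
  rewrite /Rintegral; congr fine; apply: (shift0 (fun x => h x + k x)).
    by move=> x; apply: cvgD; [exact: ch|exact: ck].
  by move=> x; have := hk x; rewrite ler_norml; lra.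
have kE : \int[mu]_x (k (x + c)) = \int[mu]_x (k x).
  by rewrite /Rintegral; congr fine; exact: shift0.
move: hkE; by rewrite RintegralD// RintegralD// kE => /addIr.
Qed.

End CIntegral.

(** * Functions of Gaussian decay and their two-sided Laplace transforms *)

Section Gauss.
Context {R : realType}.
Local Notation mu := (@lebesgue_measure R).
Implicit Types (G : R -> R[i]) (h : R -> R) (z : R[i]).

(** Completing the square: the integrand is a multiple of the normal density of mean q / p and
    variance 1 / p. *)
Lemma gauss_integral_shift (p q : R) : 0 < p ->
  mu.-integrable setT (EFin \o (fun x => expR (- p * x ^+ 2 / 2 + q * x))) /\
  \int[mu]_x expR (- p * x ^+ 2 / 2 + q * x) = Num.sqrt (2 * pi / p) * expR (q ^+ 2 / (2 * p)).
Proof.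
move=> p0; have pi0 := pi_gt0 R.
pose s : R := (Num.sqrt p)^-1; pose m := q / p.
have s0 : s != 0 by rewrite invr_eq0 gt_eqF ?sqrtr_gt0.
have s2 : s ^+ 2 = p^-1 by rewrite exprVn sqr_sqrtr// ltW.
have E x : expR (- p * x ^+ 2 / 2 + q * x) =
    (Num.sqrt (2 * pi / p) * expR (q ^+ 2 / (2 * p))) * normal_pdf m s x.
  rewrite normal_pdfE// /normal_peak /normal_fun s2.
  rewrite (_ : p^-1 * pi *+ 2 = 2 * pi / p); last by rewrite -mulr_natl; ring.
  rewrite mulrACA divff ?mul1r; last by rewrite gt_eqF// sqrtr_gt0 divr_gt0// mulr_gt0.
  rewrite -expRD; congr expR; rewrite /m -mulr_natl; field.
  by rewrite gt_eqF.
have I := integrable_normal_pdf m s.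
have EF : (fun x => expR (- p * x ^+ 2 / 2 + q * x)) =
    (fun x => (Num.sqrt (2 * pi / p) * expR (q ^+ 2 / (2 * p))) * normal_pdf m s x).
  by apply/funext.
rewrite EF; split.
  exact: (integrableZl measurableT (Num.sqrt (2 * pi / p) * expR (q ^+ 2 / (2 * p))) I).
by rewrite RintegralZl// /Rintegral integral_normal_pdf /= mulr1.
Qed.

Lemma measurable_gauss_norm (p c : R) :
  measurable_fun setT (fun x : R => expR (- p * x ^+ 2 / 2 + c * `|x|)).
Proof.
apply: measurableT_comp => //; apply: measurable_funD.
  by apply: measurable_funM => //; apply: measurable_funM => //; exact: measurable_funX.
by apply: measurable_funM => //; exact: measurableT_comp.
Qed.

Lemma integrable_gauss_norm (p c : R) : 0 < p ->
  mu.-integrable setT (EFin \o (fun x => expR (- p * x ^+ 2 / 2 + c * `|x|))).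
Proof.
move=> p0; have [I1 _] := gauss_integral_shift c p0; have [I2 _] := gauss_integral_shift (- c) p0.
apply: le_integrable (integrableD measurableT I1 I2) => //.
  by apply/measurable_EFinP; exact: measurable_gauss_norm.
move=> x _; rewrite /= lee_fin (ger0_norm (expR_ge0 _)) (ger0_norm (addr_ge0 (expR_ge0 _) (expR_ge0 _))).
have [x0|x0] := ger0P x; first by rewrite lerDl expR_ge0.
by rewrite mulrN -mulNr lerDr expR_ge0.
Qed.

(** The linear term [c * |x|] makes the class stable under multiplication by exponentials and
    polynomials, with the Gaussian rate [p] unchanged. *)
Definition gauss_bounded G := cmeasurable G /\ exists M p c : R,
  [/\ 0 <= M, 0 < p, 0 <= c & forall x, normc (G x) <= M * expR (- p * x ^+ 2 / 2 + c * `|x|)].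

Lemma gauss_bounded_cintegrable G : gauss_bounded G -> cintegrable G.
Proof.
move=> [mG [M [p [c [M0 p0 c0 GM]]]]].
exact: cintegrable_le mG (integrableZl measurableT M (integrable_gauss_norm c p0)) GM.
Qed.

Lemma gauss_boundedM G (w : R -> R[i]) (M' c' : R) : gauss_bounded G ->
  cmeasurable w -> 0 <= c' -> (forall x, normc (w x) <= M' * expR (c' * `|x|)) ->
  gauss_bounded (fun x => G x * w x).
Proof.
move=> [mG [M [p [c [M0 p0 c0 GM]]]]] mw c'0 wM.
have M'0 : 0 <= M'.
  have := le_trans (normc_ge0 _) (wM 0); rewrite pmulr_lge0 ?expR_gt0//.
split; first exact: cmeasurableM.
exists (M * M'), p, (c + c'); split; rewrite ?addr_ge0 ?mulr_ge0// => x.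
by rewrite normcM mulrDl addrA expRD mulrACA ler_pM ?normc_ge0.
Qed.

Lemma cmeasurable_expz z : cmeasurable (fun x : R => cexp (z * x%:C)).
Proof.
apply: cmeasurable_cexp; apply: cmeasurableM; first exact: cmeasurable_cst.
exact: cmeasurable_real.
Qed.

Lemma normc_expz_le z (x : R) : normc (cexp (z * x%:C)) <= 1 * expR (normc z * `|x|).
Proof.
rewrite mul1r normc_cexp ler_expR (le_trans (ler_norm _))// (le_trans (ler_Re_normc _))//.
by rewrite normcM normc_real.
Qed.

Lemma gauss_bounded_expz G z : gauss_bounded G -> gauss_bounded (fun x => G x * cexp (z * x%:C)).
Proof.
by move=> gG; apply: (gauss_boundedM gG (cmeasurable_expz z) (normc_ge0 z) (normc_expz_le z)).
Qed.

Lemma gauss_bounded_mulx G : gauss_bounded G -> gauss_bounded (fun x => G x * x%:C).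
Proof.
move=> gG; apply: (gauss_boundedM gG (M' := 1) (c' := 1)) => //; first exact: cmeasurable_real.
move=> x; rewrite normc_real !mul1r; have := expR_ge1Dx `|x|; lra.
Qed.

Definition laplace G z := cintegral (fun x => G x * cexp (z * x%:C)).

(** The expansion is taken under the integral: the coefficients are moments of [G x * cexp (z * x)],
    and the error is the integral against [cexp_rem 3 (x * h)], which is at most [|h|^3] times a
    Gaussian-bounded function. *)
Lemma jet2_laplace G z : gauss_bounded G -> jet2 (laplace G) z.
Proof.
move=> gG; have gE w := gauss_bounded_expz w gG.
have gx := gauss_bounded_mulx (gE z); have gxx := gauss_bounded_mulx gx.
have iE w := gauss_bounded_cintegrable (gE w).
have ix := gauss_bounded_cintegrable gx; have ixx := gauss_bounded_cintegrable gxx.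
set c1 := cintegral (fun x => G x * cexp (z * x%:C) * x%:C).
set c2 := cintegral (fun x => G x * cexp (z * x%:C) * x%:C * x%:C).
exists c1, (2^-1 * c2).
have remE (h : R[i]) : laplace G (z + h) - laplace G z - c1 * h - 2^-1 * c2 * h ^+ 2 =
    cintegral (fun x => G x * cexp (z * x%:C) * cexp_rem 3 (x%:C * h)).
  rewrite (_ : c1 * h = h * c1); last by ring.
  rewrite (_ : 2^-1 * c2 * h ^+ 2 = (2^-1 * h ^+ 2) * c2); last by ring.
  rewrite /laplace -cintegralB// -cintegralMl// -cintegralB//; [|exact: cintegrableB|exact: cintegrableMl].
  rewrite -cintegralMl// -cintegralB//; [|apply: cintegrableB; [exact: cintegrableB|exact: cintegrableMl]|exact: cintegrableMl].
  congr cintegral; apply/funext => x.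
  rewrite mulrDl cexpD /cexp_rem !big_ord_recr big_ord0 /= expr0 expr1.
  rewrite (_ : 0`! = 1)%N// (_ : 1`! = 1)%N// (_ : 2`! = 2)%N// (mulrC h).
  by field.
have [mE [M [p [c [M0 p0 c0 EM]]]]] := gE z.
pose I := \int[mu]_x (M * expR (- p * x ^+ 2 / 2 + (c + 1) * `|x|)).
exists I, 1; split => //.
  by apply: Rintegral_ge0 => x _; rewrite mulr_ge0 ?expR_ge0.
move=> h h1; rewrite remE mulrC.
have iI := integrableZl measurableT M (integrable_gauss_norm (c + 1) p0).
rewrite /I -RintegralZl//.
have mh : cmeasurable (fun x : R => G x * cexp (z * x%:C) * cexp_rem 3 (x%:C * h)).
  apply: cmeasurableM => //; rewrite /cexp_rem.
  have mx : cmeasurable (fun x : R => x%:C * h).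
    by apply: cmeasurableM; [exact: cmeasurable_real|exact: cmeasurable_cst].
  apply: cmeasurableD; first exact: cmeasurable_cexp.
  under eq_fun do rewrite -mulN1r; apply: cmeasurableM; first exact: cmeasurable_cst.
  under eq_fun do rewrite !big_ord_recr big_ord0 /= expr0 expr1 add0r expr2.
  apply: cmeasurableD; last by apply: cmeasurableM; [exact: cmeasurableM|exact: cmeasurable_cst].
  by apply: cmeasurableD; [exact: cmeasurable_cst|apply: cmeasurableM; [exact: mx|exact: cmeasurable_cst]].
have hb x : normc (G x * cexp (z * x%:C) * cexp_rem 3 (x%:C * h)) <=
    normc h ^+ 3 * (M * expR (- p * x ^+ 2 / 2 + (c + 1) * `|x|)).
  have -> : normc h ^+ 3 * (M * expR (- p * x ^+ 2 / 2 + (c + 1) * `|x|)) =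
      (M * expR (- p * x ^+ 2 / 2 + c * `|x|)) * (normc h ^+ 3 * expR `|x|).
    by rewrite mulrDl mul1r addrA expRD; ring.
  by rewrite normcM ler_pM ?normc_ge0 ?EM// cexp_rem_scale.
apply: normc_cintegral_le => //.
- exact: cintegrable_le mh (integrableZl measurableT _ iI) hb.
- exact: (integrableZl measurableT (normc h ^+ 3) iI).
Qed.

Lemma gauss_bounded_gauss (p : R) : 0 < p ->
  gauss_bounded (fun x : R => (expR (- p * x ^+ 2 / 2))%:C).
Proof.
move=> p0; split.
  by apply: cmeasurable_real; have := measurable_gauss_norm p 0; under eq_fun do rewrite mul0r addr0.
exists 1, p, 0; split => // x.
by rewrite normc_real ger0_norm ?expR_ge0// mul1r mul0r addr0.
Qed.

Lemma is_derive0_quadratic (f : R -> R) x : (exists M d : R, [/\ 0 <= M, 0 < d & forall t, `|t| <= d ->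
  `|f (x + t) - f x| <= M * t ^+ 2]) -> is_derive x 1 f 0.
Proof.
move=> [M [d [M0 d0 H]]].
have C : h^-1 *: (f (h *: (1 : R) + x) - f x) @[h --> 0^'] --> (0 : R).
  apply/cvgrPdist_le => e e0; near=> h.
  have h0 : h != 0 by near: h; exact: nbhs_dnbhs_neq.
  have hd : `|h| <= Num.min d (e / (M + 1)).
    near: h; apply: dnbhs0_le; rewrite lt_min d0 divr_gt0//; lra.
  move: hd; rewrite le_min ler_pdivlMr; last lra; move=> /andP[hd he].
  rewrite sub0r normrN normrZ normfV /GRing.scale/= mulr1 (addrC h).
  rewrite ler_pdivrMl ?normr_gt0// (le_trans (H _ hd))// -real_normK ?num_real// expr2.
  have := normr_ge0 h; nra.
apply: DeriveDef; last exact: cvg_lim.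
by apply/cvg_ex; exists 0.
Unshelve. all: by end_near. Qed.

(* [Q w = exp (- w ^ 2 / 2) * laplace G w] is invariant under real translations
   and complex differentiable, so its derivative vanishes. *)
Lemma laplace_gauss z :
  laplace (fun x : R => (expR (- 1 * x ^+ 2 / 2))%:C) z = (Num.sqrt (2 * pi))%:C * cexp (z ^+ 2 / 2).
Proof.
set G := fun x : R => _.
have gG : gauss_bounded G by exact: gauss_bounded_gauss.
pose Q w := laplace G w * cexp (- (w ^+ 2 / 2)).
have JQ w : jet2 Q w.
  apply: jet2M; first exact: jet2_laplace.
  apply: (@jet2_comp _ (fun w => - (w ^+ 2 / 2)) cexp); first exact: jet2_cexp.
  have -> : (fun w : R[i] => - (w ^+ 2 / 2)) = (fun w => (- (1 / 2)) * (w * w)).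
    by apply/funext => v; field.
  by apply: jet2Ml; apply: jet2M; exact: jet2_id.
(* The substitution x -> x - c: the exponent -(x - c)^2 / 2 + i y (x - c) equals -x^2 / 2 + (i y +
   c) x - (c^2 / 2 + i y c), and the factor [cexp (- (w ^+ 2 / 2))] compensates the constant. *)
have trans (y c : R) : Q ((0 +i* y) + c%:C) = Q (0 +i* y).
  rewrite /Q.
  have -> : laplace G (0 +i* y) = laplace G ((0 +i* y) + c%:C) * cexp (- ((0 +i* y) * c%:C + c%:C ^+ 2 / 2)).
    rewrite mulrC /laplace -cintegralMl; last exact/gauss_bounded_cintegrable/gauss_bounded_expz.
    pose g (x : R) : R[i] := G x * cexp ((0 +i* y) * x%:C).
    have gb x : normc (g x) = expR (- 1 * x ^+ 2 / 2).
      by rewrite normcM normc_real normc_cexp !ReImE /= ?mul0r ?mulr0 ?subr0 expR0 mulr1 ger0_norm ?expR_ge0.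
    have ck : continuous (fun x : R => expR (- 1 * x ^+ 2 / 2)).
      move=> x; apply: (cvg_comp (fun x : R => - 1 * x ^+ 2 / 2) expR); last exact: continuous_expR.
      by apply: cvgMl; apply: cvgMr; exact: sqr_continuous.
    have ik : mu.-integrable setT (EFin \o (fun x => expR (- 1 * x ^+ 2 / 2))).
      have [] := gauss_integral_shift 0 (@ltr01 R); under eq_fun do rewrite mul0r addr0; done.
    have cy (f : R -> R) : continuous f -> continuous (fun x : R => f (y * x)).
      by move=> cf x; apply: (cvg_comp (fun x : R => y * x) f); [apply: cvgMr; exact: cvg_id|exact: cf].
    have Reg x : Re (g x) = expR (- 1 * x ^+ 2 / 2) * cos (y * x).
      rewrite /g /G /cexp /expi !ReImE /= ?ReImE /= ?mul0r ?mulr0 ?subr0 ?add0r ?addr0 expR0; ring.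
    have Img x : Im (g x) = expR (- 1 * x ^+ 2 / 2) * sin (y * x).
      rewrite /g /G /cexp /expi !ReImE /= ?ReImE /= ?mul0r ?mulr0 ?subr0 ?add0r ?addr0 expR0; ring.
    have -> : cintegral (fun x : R => G x * cexp ((0 +i* y) * x%:C)) = cintegral (fun x => g (x + (- c))).
      apply: complex_eq => /=; symmetry.
      - apply: (@Rintegral_shift _ (fun x => Re (g x)) (fun x => expR (- 1 * x ^+ 2 / 2))) => //.
          under eq_fun do rewrite Reg; move=> x; apply: cvgM; first exact: ck.
          exact: (cy _ (@continuous_cos R)).
        by move=> x; rewrite -gb ler_Re_normc.
      - apply: (@Rintegral_shift _ (fun x => Im (g x)) (fun x => expR (- 1 * x ^+ 2 / 2))) => //.
          under eq_fun do rewrite Img; move=> x; apply: cvgM; first exact: ck.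
          exact: (cy _ (@continuous_sin R)).
        by move=> x; rewrite -gb ler_Im_normc.
    congr cintegral; apply/funext => x.
    rewrite /g /G -!cexp_real -!cexpD; congr cexp.
    by apply: complex_eq; rewrite ?expr2 !ReImE /=; field.
  by rewrite -mulrA -cexpD; congr (_ * cexp _); field.
(* Increments of [Q] along real directions vanish, so a1 t + a2 t^2 is O(t^3) for real t and a1 = 0.
   The expansion being complex, vertical increments are then O(t^2). *)
have lip (y : R) : exists M d : R, [/\ 0 <= M, 0 < d & forall t : R, `|t| <= d ->
    normc (Q (0 +i* (y + t)) - Q (0 +i* y)) <= M * t ^+ 2].
  have [a1 [a2 H]] := JQ (0 +i* y).
  have a10 : a1 = 0.
    apply: normc_eq0; apply/eqP; rewrite eq_le normc_ge0 andbT.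
    have [M [d [M0 d0 d1 HM]]] := H.
    apply/ler_addgt0Pr => e e0; rewrite add0r.
    have K0 : 0 < normc a2 + M + 1 by have := normc_ge0 a2; lra.
    pose t : R := Num.min d (e / (normc a2 + M + 1)).
    have t0 : 0 < t by rewrite lt_min d0 divr_gt0.
    have td : t <= d by rewrite ge_min lexx.
    have te : t * (normc a2 + M + 1) <= e by rewrite -ler_pdivlMr// ge_min lexx orbT.
    have := HM t%:C; rewrite trans subrr sub0r normc_real gtr0_norm// => /(_ td) H1.
    have H2 : normc (a1 * t%:C) <= normc (- (a1 * t%:C) - a2 * t%:C ^+ 2) + normc (a2 * t%:C ^+ 2).
      rewrite -[X in X <= _]normcN; apply: le_trans (le_normcD _ _).
      by rewrite subrK.
    have H3 : normc a1 * t <= M * t ^+ 3 + normc a2 * t ^+ 2.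
      rewrite -{1}(gtr0_norm t0) -normc_real -normcM (le_trans H2)// lerD//.
      by rewrite normcM normcX normc_real gtr0_norm.
    have t1 : t <= 1 by exact: le_trans d1.
    have H4 : normc a1 * t <= (t * (normc a2 + M + 1)) * t.
      apply: (le_trans H3); have := normc_ge0 a2; have : t ^+ 3 <= t ^+ 2 by rewrite ler_wiXn2l// ltW.
      have := sqr_ge0 t; nra.
    by rewrite -(ler_pM2r t0) (le_trans H4)// ler_wpM2r// ltW.
  have [M [d [M0 d0 d1 HM]]] : bigO 2 (fun h : R[i] => Q ((0 +i* y) + h) - Q (0 +i* y)).
    have := bigOD (bigOW (isT : (2 <= 3)%N) H) (bigOMl a2 (bigO_X 2)).
    by congr bigO; apply/funext => h; rewrite a10; ring.
  exists M, d; split => // t td.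
  have nt : normc (0 +i* t : R[i]) = `|t| by rewrite normcE /= expr0n add0r sqrtr_sqr.
  have := HM (0 +i* t); rewrite nt => /(_ td).
  rewrite real_normK ?num_real//.
  by rewrite (_ : (0 +i* y) + (0 +i* t) = 0 +i* (y + t))//; apply: complex_eq; rewrite !ReImE /= ?addr0.
have Qy (y : R) : Q (0 +i* y) = Q 0.
  apply: complex_eq.
  - apply: (@is_derive_0_is_cst R (fun y => Re (Q (0 +i* y))) y 0) => x.
    apply: is_derive0_quadratic; have [M [d [M0 d0 HM]]] := lip x; exists M, d; split => // t td.
    by rewrite (le_trans _ (HM t td))// (le_trans _ (ler_Re_normc _))// !ReImE.
  - apply: (@is_derive_0_is_cst R (fun y => Im (Q (0 +i* y))) y 0) => x.
    apply: is_derive0_quadratic; have [M [d [M0 d0 HM]]] := lip x; exists M, d; split => // t td.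
    by rewrite (le_trans _ (HM t td))// (le_trans _ (ler_Im_normc _))// !ReImE.
have Q0 : Q 0 = (Num.sqrt (2 * pi))%:C.
  rewrite /Q expr0n mul0r oppr0 cexp0 mulr1 /laplace.
  have [_] := gauss_integral_shift 0 (@ltr01 R); rewrite expr0n mul0r expR0 mulr1 divr1 => E.
  have -> : (fun x : R => G x * cexp (0 * x%:C)) = (fun x : R => (expR (- 1 * x ^+ 2 / 2))%:C).
    by apply/funext => x; rewrite mul0r cexp0 mulr1.
  apply: complex_eq => /=; last by rewrite Rintegral_cst// mul0r.
  by rewrite -E; apply: eq_Rintegral => x _; rewrite mul0r addr0.
have Qz : Q z = (Num.sqrt (2 * pi))%:C.
  rewrite (_ : z = (0 +i* Im z) + (Re z)%:C); last by apply: complex_eq; rewrite !ReImE /= ?addr0 ?add0r.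
  by rewrite trans Qy.
by rewrite -Qz /Q -mulrA -cexpD addNr cexp0 mulr1.
Qed.

End Gauss.

(** * Hermite polynomials and roots of unity *)

Section Hermite.
Context {R : realType}.
Implicit Types (x : R) (k n N M : nat).

(** The recurrence H_(k+1) = 2 x H_k - H_k', which is what differentiating H_k(y) exp (- y^2)
    produces, up to sign. *)
Fixpoint hpoly k : {poly R} :=
  if k is k'.+1 then 2%:P * 'X * hpoly k' - (hpoly k')^`() else 1.

Arguments hpoly : simpl never.

Lemma hpoly0 : hpoly 0 = 1.
Proof. by []. Qed.

Lemma hpolyS k : hpoly k.+1 = 2%:P * 'X * hpoly k - (hpoly k)^`().
Proof. by []. Qed.



Lemma deriv_hpolyS k : (hpoly k.+1)^`() = (2 * k.+1%:R)%:P * hpoly k.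
Proof.
elim: k => [|k IH].
  by rewrite hpolyS hpoly0 derivC subr0 mulr1 derivM derivC mul0r add0r derivX !mulr1.
rewrite hpolyS derivB !derivM !derivC derivX IH derivM derivC hpolyS.
have -> : (2 * k.+2%:R)%:P = (2 * k.+1%:R)%:P + 2%:P :> {poly R}.
  by rewrite -polyCD -[k.+2%:R]natr1 mulrDr mulr1.
by ring.
Qed.

Lemma hpolySS k : hpoly k.+2 = 2%:P * 'X * hpoly k.+1 - (2 * k.+1%:R)%:P * hpoly k.
Proof. by rewrite hpolyS deriv_hpolyS. Qed.

Lemma horner_hpolySS k x :
  (hpoly k.+2).[x] = 2 * x * (hpoly k.+1).[x] - 2 * k.+1%:R * (hpoly k).[x].
Proof. by rewrite hpolySS; move: (hpoly k.+1) (hpoly k) => p q; rewrite !hornerE. Qed.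

Lemma derive1n_gauss k : ((fun y : R => expR (- y ^+ 2))^`(k))%classic =
  (fun y => (-1) ^+ k * ((hpoly k).[y] * expR (- y ^+ 2))).
Proof.
elim: k => [|k IH].
  by apply/funext => y; rewrite expr0 mul1r hpoly0 hornerC mul1r.
rewrite derive1nS IH; apply/funext => x; rewrite derive1E.
have D1 : is_derive x 1 (fun y : R => - y ^+ 2) (- (2 * x)).
  rewrite [X in is_derive _ _ X](_ : _ = - ((@id R) ^+ 2)); last first.
    by apply/funext => s; rewrite fctE exprfctE.
  apply: (is_derive_eq (is_deriveN (is_deriveX 2 (is_derive_id x (1 : R))))).
  by rewrite /GRing.scale/= mulr1 expr1.
have D2 : is_derive x 1 (fun y : R => expR (- y ^+ 2)) (- (2 * x) * expR (- x ^+ 2)).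
  by apply: (is_derive_eq (is_derive1_comp (is_derive_expR _) D1)); rewrite mulrC.
have D3 := is_deriveM (is_derive_poly (hpoly k) x) D2.
have D4 := is_deriveZ ((-1) ^+ k) D3.
have -> : (fun y => (-1) ^+ k * ((hpoly k).[y] * expR (- y ^+ 2))) =
  ((-1) ^+ k) *: (horner (hpoly k) * (fun y : R => expR (- y ^+ 2))) by apply/funext.
rewrite (@derive_val _ _ _ _ _ _ _ D4) /GRing.scale/= [(-1) ^+ k.+1]exprS.
by rewrite hornerD hornerN !hornerM hornerX hornerC; ring.
Qed.

Lemma hermite_hpoly k x : hermite k x = (hpoly k).[x].
Proof.
rewrite /hermite derive1n_gauss mulrACA -exprD addnn -mul2n exprM sqrrN expr1n expr1n mul1r.
by rewrite mulrCA -expRD addrN expR0 mulr1.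
Qed.

(** The generating function exp (2 x t - t^2) as a polynomial in t, the exponential series being cut
    after [M] terms. The n-th term is divisible by t^n, so coefficients of index below [M] are the
    true ones; those above are not. *)
Definition gen_poly x M : {poly R} :=
  \sum_(n < M) (n`!%:R^-1)%:P * ((2 * x)%:P * 'X - 'X ^+ 2) ^+ n.

Lemma deriv_gen_poly x M : (gen_poly x M.+1)^`() = ((2 * x)%:P - 2%:P * 'X) * gen_poly x M.
Proof.
rewrite /gen_poly big_ord_recl expr0 mulr1 derivD derivC add0r raddf_sum mulr_sumr.
apply: eq_bigr => i _ /=; rewrite derivM derivC mul0r add0r deriv_exp derivB derivM derivC mul0r add0r derivX derivXn.
rewrite /bump /= add1n /= mulr1 factS natrM invfM polyCM.
have e : (i.+1%:R^-1)%:P * (i.+1%:R : {poly R}) = 1.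
  by rewrite -polyC_natr -polyCM mulVf ?pnatr_eq0.
have aux (K : comNzRingType) (A B D Q n : K) : A * n = 1 -> A * B * (D * Q * n) = D * (B * Q).
  by move=> H; rewrite -[RHS]mul1r -H; ring.
by rewrite add0n expr1 -[(_ * _) *+ i.+1]mulr_natr -['X *+ 2]mulr_natl polyC_natr aux.
Qed.

(** The equation G' = (2 x - 2 t) G for the generating function survives truncation when [M] drops
    by one. On coefficients it is the three-term recurrence of the Hermite polynomials. *)
Lemma coef_gen_poly x k M : (k < M)%N -> (gen_poly x M)`_k = (hpoly k).[x] / k`!%:R.
Proof.
have [m] := ubnP k; elim: m k M => // m IH [|k] [|M]//.
  move=> _ _; rewrite -horner_coef0 /gen_poly horner_sum big_ord_recl big1 ?addr0.
    by rewrite hpoly0 !hornerE.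
  move=> i _; rewrite hornerM horner_exp hornerD hornerN hornerM hornerX hornerXn.
  by rewrite expr0n /= mulr0 subrr expr0n /= mulr0.
rewrite !ltnS => km kM.
have fk : ((k.+1)%:R : R) != 0 by rewrite pnatr_eq0.
have : ((gen_poly x M.+1)^`())`_k = (gen_poly x M.+1)`_k.+1 * k.+1%:R.
  by rewrite coef_deriv mulr_natr.
rewrite deriv_gen_poly mulrBl coefB coefCM -[2%:P * 'X * _]mulrA coefCM coefXM (IH k M km kM).
have facn n : (n`!%:R : R) != 0 by rewrite pnatr_eq0 -lt0n fact_gt0.
move=> E; apply: (mulIf fk); rewrite -E {E}.
rewrite factS natrM; case: k km kM fk => [|k] km kM fk /=.
  by rewrite mulr0 subr0 hpolyS hpoly0 derivC subr0 mulr1 hornerM hornerX !hornerC; field.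
rewrite (IH k M (ltnW km) (ltnW kM)).
rewrite horner_hpolySS factS natrM.
have := facn k; have f1 : ((k.+1)%:R : R) != 0 by rewrite pnatr_eq0.
move: fk f1; generalize (hpoly k).[x] (hpoly k.+1).[x] => u v.
move: (k.+2%:R : R) (k.+1%:R : R) (k`!%:R : R) => c1 c2 c3 h1 h2 h3.
by field; rewrite h1 h2 h3.
Qed.

Lemma size_gen_poly x M : (size (gen_poly x M) <= (2 * M).+1)%N.
Proof.
apply: (leq_trans (size_sum _ _ _)); apply/bigmax_leqP => i _.
rewrite mul_polyC (leq_trans (size_scale_leq _ _))// (leq_trans (size_poly_exp_leq _ _))//.
rewrite ltnS leq_mul//; last exact: ltnW.
rewrite -subn1 leq_subLR (leq_trans (size_polyD _ _))// size_polyN size_polyXn geq_max leqnn andbT.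
by rewrite mul_polyC (leq_trans (size_scale_leq _ _))// size_polyX.
Qed.

Lemma gen_polyE x M (t : R[i]) :
  (map_poly (real_complex R) (gen_poly x M)).[t] =
  \sum_(n < M) ((2 * x)%:C * t - t ^+ 2) ^+ n / n`!%:R.
Proof.
rewrite /gen_poly rmorph_sum /= horner_sum; apply: eq_bigr => i _.
rewrite rmorphM rmorphXn rmorphB rmorphM rmorphXn /= !map_polyC map_polyX /= !hornerE.
by rewrite fmorphV rmorph_nat mulrC.
Qed.

Definition root_unity N : R[i] := cexp (0 +i* (2 * pi / N%:R)).

Lemma root_unityX N d : root_unity N ^+ d = cexp (0 +i* (2 * (pi * d%:R / N%:R))).
Proof.
rewrite /root_unity cexpX; congr cexp; apply: complex_eq.
  by rewrite ReM /= mulr0 -(rmorph_nat (real_complex R)) /= mul0r subr0.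
by rewrite ImM /= -(rmorph_nat (real_complex R)) /= mul0r addr0; ring.
Qed.

Lemma normc_root_unityX N d : normc (root_unity N ^+ d) = 1.
Proof. by rewrite root_unityX normc_cexp expR0. Qed.

Lemma root_unity_neq0 N : root_unity N != 0.
Proof.
by apply/eqP => e; have := normc_root_unityX N 1; rewrite e expr1 normc0 => /esym/eqP; rewrite oner_eq0.
Qed.

Lemma root_unityXN N : (0 < N)%N -> root_unity N ^+ N = 1.
Proof.
move=> N0; rewrite root_unityX mulfK ?pnatr_eq0 -?lt0n//.
by apply: complex_eq; rewrite cexp_imag /expi /= mulr_natl ?cos2pi ?sin2pi.
Qed.

(** With the angle written 2 s and 0 < s < pi, the real part is 1 - 2 sin^2 s < 1. *)
Lemma root_unityX_neq1 N d : (0 < d < N)%N -> root_unity N ^+ d != 1.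
Proof.
move=> /andP[d0 dN]; have N0 : (0 < N)%N by exact: leq_trans dN.
apply/eqP => /(congr1 (@Re R)); rewrite root_unityX cexp_imag /expi /= mulr_natl cos_mulr2n.
set s := pi * _ / _.
have s0 : 0 < sin s.
  apply: sin_gt0_pi; rewrite /s divr_gt0 ?mulr_gt0 ?pi_gt0 ?ltr0n//=.
  by rewrite ltr_pdivrMr ?ltr0n// ltr_pM2l ?pi_gt0// ltr_nat.
rewrite cos2sin2 mulr2n; nra.
Qed.

Lemma root_unity_sum N m k : (m < N)%N -> (k < N)%N ->
  \sum_(j < N) (root_unity N ^+ m / root_unity N ^+ k) ^+ j = if m == k then N%:R else 0.
Proof.
move=> mN kN; have N0 : (0 < N)%N by exact: leq_trans mN.
have w0 := root_unity_neq0 N.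
case: eqVneq => [->|mk].
  under eq_bigr do rewrite divff ?expf_neq0// expr1n.
  by rewrite sumr_const card_ord.
set u := _ / _.
have uN : u ^+ N = 1 by rewrite expr_div_n -!exprM !(mulnC _ N) !exprM root_unityXN// !expr1n divr1.
have u1 : u != 1.
  rewrite /u; have [mk'|km] := ltnP m k.
    rewrite -(subnK (ltnW mk')) exprD invfM mulrA mulrAC divff ?expf_neq0// mul1r.
    by rewrite invr_eq1 root_unityX_neq1// subn_gt0 mk' (leq_ltn_trans (leq_subr _ _)).
  rewrite -(subnK km) exprD mulfK ?expf_neq0// root_unityX_neq1// subn_gt0.
  by rewrite ltn_neqAle eq_sym mk km (leq_ltn_trans (leq_subr _ _)).
apply: (mulfI (x := u - 1)); first by rewrite subr_eq0.
by rewrite -subrX1 uN subrr mulr0.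
Qed.

(** A discrete Cauchy formula. As the degree is below [N], distinct exponents stay distinct modulo
    [N], and the orthogonality of [root_unity_sum] isolates one coefficient exactly. *)
Lemma coef_root_unity (p : {poly R[i]}) N k (r : R[i]) : (size p <= N)%N -> (k < N)%N ->
  \sum_(j < N) p.[r * root_unity N ^+ j] / (root_unity N ^+ k) ^+ j = N%:R * (p`_k * r ^+ k).
Proof.
move=> pN kN.
have E i j : p`_i * (r * root_unity N ^+ j) ^+ i / (root_unity N ^+ k) ^+ j =
    (p`_i * r ^+ i) * (root_unity N ^+ i / root_unity N ^+ k) ^+ j.
  by rewrite exprMn expr_div_n -!exprM (mulnC j i) !mulrA.
under eq_bigr do rewrite (horner_coef_wide _ pN) mulr_suml.
rewrite exchange_big /= (bigD1 (Ordinal kN)) //= [X in _ + X]big1 ?addr0.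
  under eq_bigr do rewrite E.
  by rewrite -mulr_sumr root_unity_sum// eqxx mulrC.
move=> i ik; under eq_bigr do rewrite E.
rewrite -mulr_sumr root_unity_sum// ifF ?mulr0//.
by apply/negbTE; apply: contra ik => /eqP ik; apply/eqP/val_inj.
Qed.

End Hermite.

(** * The Bargmann transform *)

Section Bargmann.
Context {R : realType}.
Local Notation mu := (@lebesgue_measure R).
Implicit Types (f : R -> R[i]) (t z : R[i]) (x y u v a C K : R).

Lemma Re_cexp z : Re (cexp z) = expR (Re z) * cos (Im z).
Proof. by rewrite ReM /= mul0r subr0. Qed.

Lemma Im_cexp z : Im (cexp z) = expR (Re z) * sin (Im z).
Proof. by rewrite ImM /= mul0r addr0. Qed.



(** The factor [- 1] keeps the shape [- p * x ^+ 2 / 2] shared by the Gaussian lemmas. *)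
Definition gauss_weight f (x : R) : R[i] := f x * (expR (- 1 * x ^+ 2 / 2))%:C.

(* Pairing with the generating function exp (2 x t - t ^ 2 - x ^ 2 / 2) of the
   Hermite functions. *)
Definition bargmann f t : R[i] :=
  ((Num.sqrt (2 * pi))^-1)%:C * (cexp (- t ^+ 2) * laplace (gauss_weight f) (2 * t)).

Lemma mulr_expRD C x y : C * expR x * expR y = C * expR (x + y).
Proof. by rewrite -mulrA expRD. Qed.

Lemma normc_gauss_weight_le f a C x :
  normc (f x) <= C * expR (- a * x ^+ 2 / 2) ->
  normc (gauss_weight f x) <= C * expR (- (1 + a) * x ^+ 2 / 2).
Proof.
move=> fC; rewrite /gauss_weight normcM normc_real ger0_norm ?expR_ge0//.
rewrite (le_trans (ler_wpM2r (expR_ge0 _) fC))// mulr_expRD.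
by rewrite le_eqVlt; apply/orP; left; apply/eqP; congr (_ * expR _); field.
Qed.

Lemma gauss_bounded_weight f a C : cmeasurable f -> 0 < a ->
  (forall x, normc (f x) <= C * expR (- a * x ^+ 2 / 2)) -> gauss_bounded (gauss_weight f).
Proof.
move=> mf a0 fC; have C0 : 0 <= C.
  by have := le_trans (normc_ge0 _) (fC 0); rewrite pmulr_lge0 ?expR_gt0.
have [mg _] := gauss_bounded_gauss (@ltr01 R).
split; first exact: cmeasurableM.
exists C, (1 + a), 0; split => //; first by lra.
by move=> x; rewrite mul0r addr0 normc_gauss_weight_le.
Qed.

Lemma jet2_bargmann f t : gauss_bounded (gauss_weight f) -> jet2 (bargmann f) t.
Proof.
move=> gf; apply: jet2Ml; apply: jet2M.
  apply: (@jet2_comp _ (fun w => - w ^+ 2) cexp); first exact: jet2_cexp.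
  have -> : (fun w : R[i] => - w ^+ 2) = (fun w => (- 1) * (w * w)).
    by apply/funext => w; ring.
  by apply: jet2Ml; apply: jet2M; exact: jet2_id.
apply: (@jet2_comp _ (fun w => 2 * w) (laplace (gauss_weight f))); first exact: jet2_laplace.
by apply: jet2Ml; exact: jet2_id.
Qed.

Lemma normc_laplace_le (G : R -> R[i]) z C p : 0 < p -> cintegrable (fun x : R => G x * cexp (z * x%:C)) ->
  (forall x, normc (G x) <= C * expR (- p * x ^+ 2 / 2)) ->
  normc (cintegral (fun x : R => G x * cexp (z * x%:C))) <=
    C * (Num.sqrt (2 * pi / p) * expR (Re z ^+ 2 / (2 * p))).
Proof.
move=> p0 iG GC; have [I E] := gauss_integral_shift (Re z) p0.
rewrite -E -RintegralZl//; apply: normc_cintegral_le => //.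
  exact: (integrableZl measurableT C I).
move=> x; rewrite normcM normc_cexp expRD mulrA.
have -> : Re (z * x%:C) = Re z * x by rewrite ReM /= mulr0 subr0.
by rewrite ler_wpM2r ?expR_ge0.
Qed.

Lemma sqrt_gauss_const (p : R) : 0 < p ->
  (Num.sqrt (2 * pi))^-1 * Num.sqrt (2 * pi / p) = (Num.sqrt p)^-1.
Proof.
move=> p0; have pi2 : 0 < 2 * pi :> R by rewrite mulr_gt0 ?pi_gt0.
rewrite [Num.sqrt (2 * pi / p)]sqrtrM ?(ltW pi2)// mulrA mulVf ?mul1r; last by rewrite gt_eqF// sqrtr_gt0.
by rewrite sqrtrV// ltW.
Qed.

Lemma ReX2 z : Re (z ^+ 2) = Re z ^+ 2 - Im z ^+ 2.
Proof. by rewrite !expr2 ReM. Qed.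

(** The weighted function decays at rate 1 + a, so its Laplace transform at 2 t contributes 2 u^2 /
    (1 + a), with t = u + i v. Adding the -u^2 + v^2 of exp (- t^2) gives the coefficient 2 / (1 +
    a) - 1 = (1 - a) / (1 + a). *)
Lemma bargmann_bound f a C t : cmeasurable f -> 0 < a ->
  (forall x, normc (f x) <= C * expR (- a * x ^+ 2 / 2)) ->
  normc (bargmann f t) <= C / Num.sqrt (1 + a) * expR ((1 - a) / (1 + a) * Re t ^+ 2 + Im t ^+ 2).
Proof.
move=> mf a0 fC; have gf := gauss_bounded_weight mf a0 fC.
have a1 : 0 < 1 + a by lra.
have gC x := normc_gauss_weight_le (fC x).
have := normc_laplace_le a1 (gauss_bounded_cintegrable (gauss_bounded_expz (2 * t) gf)) gC.
have -> : Re (2 * t) = 2 * Re t by rewrite mulr_natl mulr2n ReD mulr_natl mulr2n.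
rewrite /bargmann (normcM _%:C) (normcM (cexp _)) normc_real normc_cexp ReN ReX2.
rewrite ger0_norm ?invr_ge0 ?sqrtr_ge0// => H.
apply: (le_trans (ler_wpM2l _ (ler_wpM2l (expR_ge0 _) H))); first by rewrite invr_ge0 sqrtr_ge0.
rewrite -(sqrt_gauss_const a1).
have -> : (1 - a) / (1 + a) * Re t ^+ 2 + Im t ^+ 2 =
    - (Re t ^+ 2 - Im t ^+ 2) + (2 * Re t) ^+ 2 / (2 * (1 + a)).
  by field; rewrite gt_eqF.
rewrite expRD le_eqVlt; apply/orP; left; apply/eqP; ring.
Qed.

Lemma cmeasurable_expi d (T : measurableType d) (h : T -> R) :
  measurable_fun setT h -> cmeasurable (fun x : T => expi (h x)).
Proof.
move=> mh; split => /=; apply: measurableT_comp => //.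
- by apply: continuous_measurable_fun; exact: (@continuous_cos R).
- by apply: continuous_measurable_fun; exact: (@continuous_sin R).
Qed.

Lemma measurable_expi_mul : cmeasurable (fun p : R * R => expi (- (p.1 * p.2))).
Proof.
apply: cmeasurable_expi.
by apply: measurableT_comp => //; exact: measurable_funM.
Qed.

(* Parseval's formula: exp (2 x t - x ^ 2 / 2) is, up to a factor, the Fourier
   transform of a Gaussian with a complex linear term. *)
Lemma laplace_fourier f a C t : cmeasurable f -> cintegrable f -> 0 < a ->
  (forall x, normc (f x) <= C * expR (- a * x ^+ 2 / 2)) ->
  let g := fun xi : R => (expR (- 1 * xi ^+ 2 / 2))%:C * fourier f xi * cexp (2 * ('i%C * t) * xi%:C) in
  cintegrable g /\
  laplace (gauss_weight f) (2 * t) = cexp (2 * t ^+ 2) * cintegral g.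
Proof.
move=> mf If a0 fC g; have pi2 : 0 < 2 * pi :> R by rewrite mulr_gt0 ?pi_gt0.
set c : R[i] := (Num.sqrt (2 * pi))%:C.
have c0 : c != 0 by rewrite /c eq_complex /= negb_and gt_eqF ?sqrtr_gt0.
pose w (xi : R) : R[i] := (expR (- 1 * xi ^+ 2 / 2))%:C * cexp (2 * ('i%C * t) * xi%:C).
have [mgg _] := gauss_bounded_gauss (@ltr01 R).
have mw : cmeasurable w by apply: cmeasurableM => //; exact: cmeasurable_expz.
(* The first coordinate is the frequency. Integrating out x gives a multiple of [g]; integrating out
   the frequency evaluates [laplace_gauss] at i (2 t - x), whose exponent -(2 t - x)^2 / 2 = -2 t^2
   + 2 t x - x^2 / 2 restores the weight and the Laplace kernel. *)
pose k (p : R * R) : R[i] := w p.1 * (f p.2 * expi (- (p.1 * p.2))).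
have mk : cmeasurable k.
  apply: cmeasurableM.
    by case: mw => w1 w2; split; [exact: (measurableT_comp w1 measurable_fst)|exact: (measurableT_comp w2 measurable_fst)].
  apply: cmeasurableM; last exact: measurable_expi_mul.
  by case: mf => f1 f2; split; [exact: (measurableT_comp f1 measurable_snd)|exact: (measurableT_comp f2 measurable_snd)].
have iha : mu.-integrable setT (EFin \o (fun x => C * expR (- a * x ^+ 2 / 2))).
  have := integrableZl measurableT C (integrable_gauss_norm 0 a0).
  by congr (_.-integrable _ _); apply/funext => x; rewrite /= mul0r addr0.
have nexpi (s : R) : normc (expi s) = 1 by rewrite -cexp_imag normc_cexp expR0.
have kb (xi x : R) : normc (k (xi, x)) <=
    expR (- 1 * xi ^+ 2 / 2 + normc (2 * ('i%C * t)) * `|xi|) * (C * expR (- a * x ^+ 2 / 2)).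
  rewrite /k /w /= (normcM (_ * _)) (normcM (f x)) (normcM (expR _)%:C) nexpi mulr1 normc_real ger0_norm ?expR_ge0// expRD.
  rewrite ler_pM ?mulr_ge0 ?expR_ge0 ?normc_ge0//.
  by rewrite ler_wpM2l ?expR_ge0// -[leRHS]mul1r normc_expz_le.
have [I E] := cintegral_fubini mk (integrable_gauss_norm _ (@ltr01 R)) iha kb.
have fI (xi : R) : cintegrable (fun x => f x * expi (- (xi * x))).
  apply: (cintegrable_le _ iha).
    apply: cmeasurableM; first exact: mf.
    apply: (@cmeasurable_expi _ _ (fun x : R => - (xi * x))).
    by apply: measurableT_comp => //; exact: measurable_funM.
  by move=> x; rewrite normcM nexpi mulr1.
have gE (xi : R) : cintegral (fun x => k (xi, x)) = c * g xi.
  have -> : (fun x => k (xi, x)) = (fun x => w xi * (f x * expi (- (xi * x)))) by [].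
  have cV : ((Num.sqrt (2 * pi))^-1)%:C = c^-1 :> R[i] by exact: fmorphV.
  rewrite (cintegralMl (w xi) (fI xi)) /g /fourier cV /w.
  set A := (expR _)%:C; set B := cexp _; set J := cintegral _.
  by move: c0; generalize A B c J => A' B' c' J' c0; field.
have kE (x : R) : cintegral (fun xi => k (xi, x)) =
    c * cexp (- (2 * t ^+ 2)) * (gauss_weight f x * cexp (2 * t * x%:C)).
  have -> : (fun xi => k (xi, x)) = (fun xi : R => f x * ((expR (- 1 * xi ^+ 2 / 2))%:C *
      cexp ((2 * ('i%C * t) - 'i%C * x%:C) * xi%:C))).
    apply/funext => xi; rewrite /k /w /= -cexp_imag mulrBl cexpD.
    rewrite (_ : - ('i%C * x%:C * xi%:C) = 0 +i* - (xi * x)); first ring.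
    by apply: complex_eq; rewrite !ReImE /=; ring.
  rewrite cintegralMl; last by apply: gauss_bounded_cintegrable; apply: gauss_bounded_expz; exact: gauss_bounded_gauss.
  rewrite -/(laplace (fun xi : R => (expR (- 1 * xi ^+ 2 / 2))%:C) _) laplace_gauss -/c /gauss_weight.
  rewrite -cexp_real.
  have -> : (2 * ('i%C * t) - 'i%C * x%:C) ^+ 2 / 2 =
      - (2 * t ^+ 2) + ((- 1 * x ^+ 2 / 2)%:C + 2 * t * x%:C) :> R[i].
    have -> : ((- 1 * x ^+ 2 / 2)%:C : R[i]) = - (x%:C ^+ 2 / 2).
      by apply: complex_eq; rewrite ?expr2 !ReImE /= ; field.
    have i2 : 'i%C ^+ 2 = -1 :> R[i] by exact: sqr_i.
    transitivity ('i%C ^+ 2 * (2 * t - x%:C) ^+ 2 / 2); first by field.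
    by rewrite i2; field.
  by rewrite !cexpD; ring.
have I2 : cintegrable g.
  have := cintegrableMl c^-1 I; congr cintegrable; apply/funext => xi.
  by rewrite gE mulKf.
have I3 : cintegrable (fun x : R => gauss_weight f x * cexp (2 * t * x%:C)).
  apply: gauss_bounded_cintegrable; apply: gauss_bounded_expz.
  exact: (gauss_bounded_weight mf a0 fC).
have E1 : cintegral (fun xi => cintegral (fun x => k (xi, x))) = c * cintegral g.
  by rewrite -(cintegralMl c I2); congr cintegral; apply/funext => xi; exact: gE.
have E2 : cintegral (fun x => cintegral (fun xi => k (xi, x))) =
    c * cexp (- (2 * t ^+ 2)) * laplace (gauss_weight f) (2 * t).
  by rewrite -(cintegralMl _ I3); congr cintegral; apply/funext => x; exact: kE.
split; first exact: I2.
move: E; rewrite E1 E2.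
rewrite -mulrA => /(mulfI c0) ->.
by rewrite mulrA -cexpD subrr cexp0 mul1r.
Qed.

(** By [laplace_fourier] the transform of f at t is that of its Fourier transform at i t: indeed exp
    (- t^2) exp (2 t^2) = exp (- (i t)^2). This exchanges the squares of the real and imaginary
    parts in the bound. *)
Lemma bargmann_fourier_bound f a C t : cmeasurable f -> cintegrable f -> 0 < a ->
  (forall x, normc (f x) <= C * expR (- a * x ^+ 2 / 2)) ->
  (forall x, normc (fourier f x) <= C * expR (- a * x ^+ 2 / 2)) ->
  normc (bargmann f t) <= C / Num.sqrt (1 + a) * expR (Re t ^+ 2 + (1 - a) / (1 + a) * Im t ^+ 2).
Proof.
move=> mf If a0 fC FC; have a1 : 0 < 1 + a by lra.
have [Ig E] := laplace_fourier t mf If a0 fC.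
have gC x : normc ((expR (- 1 * x ^+ 2 / 2))%:C * fourier f x) <= C * expR (- (1 + a) * x ^+ 2 / 2).
  by rewrite mulrC; exact: (normc_gauss_weight_le (FC x)).
have := normc_laplace_le a1 Ig gC.
have -> : Re (2 * ('i%C * t)) = - 2 * Im t.
  by rewrite mulr_natl mulr2n ReD !ReM /=; ring.
rewrite /bargmann E [cexp _ * _]mulrA -cexpD (normcM _%:C) (normcM (cexp _)) normc_real normc_cexp.
have -> : Re (- t ^+ 2 + 2 * t ^+ 2) = Re t ^+ 2 - Im t ^+ 2.
  by rewrite -ReX2; congr Re; ring.
rewrite ger0_norm ?invr_ge0 ?sqrtr_ge0// => H.
rewrite mulrA.
apply: (le_trans (ler_wpM2l _ H)); first by rewrite mulr_ge0 ?expR_ge0// invr_ge0 sqrtr_ge0.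
rewrite -(sqrt_gauss_const a1).
have -> : Re t ^+ 2 + (1 - a) / (1 + a) * Im t ^+ 2 =
    (Re t ^+ 2 - Im t ^+ 2) + (- 2 * Im t) ^+ 2 / (2 * (1 + a)).
  by field; rewrite gt_eqF.
rewrite [in leRHS]expRD le_eqVlt; apply/orP; left; apply/eqP; ring.
Qed.

Lemma quadrant_bound (F : R[i] -> R[i]) a K u v :
  (forall z, jet2 F z) -> 0 < a -> a < 1 ->
  (forall t, normc (F t) <= K * expR ((1 - a) / (1 + a) * Re t ^+ 2 + Im t ^+ 2)) ->
  (forall t, normc (F t) <= K * expR (Re t ^+ 2 + (1 - a) / (1 + a) * Im t ^+ 2)) ->
  0 <= u -> 0 <= v ->
  normc (F (u +i* v)) <= K * expR (Num.sqrt ((1 - a) / (1 + a)) * (u ^+ 2 + v ^+ 2)).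
Proof.
move=> JF a0 a1 F1 F2 u0 v0.
have K0 : 0 <= K.
  by have := le_trans (normc_ge0 _) (F1 0); rewrite pmulr_lge0 ?expR_gt0.
(* The origin is invisible in logarithmic coordinates; there the hypothesis itself is the claim. *)
have [uv0|uv0] := eqVneq (u ^+ 2 + v ^+ 2) 0.
  move: uv0 => /eqP; rewrite paddr_eq0 ?sqr_ge0// !sqrf_eq0 => /andP[/eqP -> /eqP ->].
  by have := F1 0; rewrite /= expr0n /= !mulr0 addr0 mulr0.
pose r := Num.sqrt (u ^+ 2 + v ^+ 2).
have r0 : 0 < r by rewrite sqrtr_gt0 lt_neqAle eq_sym uv0 addr_ge0 ?sqr_ge0.
have r2 : r ^+ 2 = u ^+ 2 + v ^+ 2 by rewrite sqr_sqrtr// addr_ge0 ?sqr_ge0.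
have ur : u <= r by rewrite -(ler_pXn2r (n := 2)) ?nnegrE ?(ltW r0)// r2; have := sqr_ge0 v; lra.
have cr : 0 <= u / r <= 1 by rewrite divr_ge0 ?(ltW r0)//= ler_pdivrMr ?mul1r.
have cr' : -1 <= u / r <= 1 by lra.
pose th := acos (u / r).
have thc : cos th = u / r by rewrite /th acosK// in_itv.
have ths : sin th = v / r.
  rewrite /th sin_acos// -(ger0_norm (divr_ge0 v0 (ltW r0))) -sqrtr_sqr; congr Num.sqrt.
  have rn : r != 0 by rewrite gt_eqF.
  rewrite !expr_div_n; apply: (mulIf (expf_neq0 2 rn)).
  by rewrite mulrBl !divfK ?expf_neq0// mul1r r2; ring.
have th0 : 0 <= th <= pi / 2.
  rewrite acos_ge0//=; rewrite leNgt; apply/negP => H.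
  have : cos th < cos (pi / 2).
    rewrite ltr_cos ?in_itv/=; have := pi_gt0 R => p0.
    - exact: H.
    - by apply/andP; split; lra.
    - by rewrite /th acos_ge0// acos_lepi.
  by rewrite cos_pihalf thc; lra.
(* Here (Re t)^2 and (Im t)^2 are |t|^2 (1 - sin 2y) / 2 and |t|^2 (1 + sin 2y) / 2. According to
   the sign of sin 2y, one picks the hypothesis that puts the small coefficient (1 - a) / (1 + a) on
   the larger square. *)
have HF x y : normc (F (cexp (x +i* (pi / 4 + y)))) <=
    K * expR (expR (2 * x) * ((1 - a * `|sin (2 * y)|) / (1 + a))).
  set t := cexp _.
  have ct : Re t ^+ 2 = expR (2 * x) * ((1 - sin (2 * y)) / 2) /\
            Im t ^+ 2 = expR (2 * x) * ((1 + sin (2 * y)) / 2).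
    have e2 : expR (2 * x) = expR x ^+ 2 by rewrite -expRM_natl mulr_natl.
    have s2 : sin (2 * y) = - cos (2 * (pi / 4 + y)).
      by rewrite mulrDr (_ : 2 * (pi / 4) = pi / 2 :> R); [rewrite addrC cosDpihalf opprK|field].
    have c2 : cos (2 * (pi / 4 + y)) = 2 * cos (pi / 4 + y) ^+ 2 - 1.
      by rewrite mulr_natl cos_mulr2n mulr_natl.
    rewrite s2 c2 /t Re_cexp Im_cexp /= !exprMn sin2cos2 e2.
    by split; field.
  have a1' : 0 < 1 + a by lra.
  have [s0|s0] := ger0P (sin (2 * y)).
    apply: (le_trans (F2 t)); rewrite ct.1 ct.2 ler_wpM2l// ler_expR le_eqVlt; apply/orP; left; apply/eqP.
    by field; rewrite gt_eqF.
  apply: (le_trans (F1 t)); rewrite ct.1 ct.2 ler_wpM2l// ler_expR le_eqVlt; apply/orP; left; apply/eqP.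
  by field; rewrite gt_eqF.
have := phragmen_lindelof JF a0 a1 K0 HF (ln r) (y := th - pi / 4).
have -> : cexp (ln r +i* (pi / 4 + (th - pi / 4))) = u +i* v.
  by rewrite addrC subrK; apply: complex_eq; rewrite ?Re_cexp ?Im_cexp /= lnK ?posrE// ?thc ?ths mulrC divfK// gt_eqF.
have -> : expR (2 * ln r) = u ^+ 2 + v ^+ 2.
  by rewrite -r2 expRM_natl lnK.
by apply; rewrite ler_norml; lra.
Qed.

(** A rotation carries the given quadrant to the first one. A quarter turn exchanges the squares of
    the real and imaginary parts, hence the two hypotheses; a half turn preserves both. *)
Lemma plane_bound (F : R[i] -> R[i]) a K t :
  (forall z, jet2 F z) -> 0 < a -> a < 1 ->
  (forall t, normc (F t) <= K * expR ((1 - a) / (1 + a) * Re t ^+ 2 + Im t ^+ 2)) ->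
  (forall t, normc (F t) <= K * expR (Re t ^+ 2 + (1 - a) / (1 + a) * Im t ^+ 2)) ->
  normc (F t) <= K * expR (Num.sqrt ((1 - a) / (1 + a)) * normc t ^+ 2).
Proof.
move=> JF a0 a1 F1 F2; rewrite sqr_normcE.
have Jc c z : jet2 (fun z => F (c * z)) z.
  by apply: (@jet2_comp _ (fun z => c * z) F) => //; apply: jet2Ml; exact: jet2_id.
case: t => u v /=.
have i1 w : Re ('i%C * w) = - Im w :> R by rewrite ReM /=; ring.
have i2 w : Im ('i%C * w) = Re w :> R by rewrite ImM /=; ring.
have n1 w : Re (- 'i%C * w) = Im w :> R by rewrite mulNr ReN i1 opprK.
have n2 w : Im (- 'i%C * w) = - Re w :> R by rewrite mulNr ImN i2.
have m1 w : Re (- 1 * w) = - Re w :> R by rewrite mulN1r ReN.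
have m2 w : Im (- 1 * w) = - Im w :> R by rewrite mulN1r ImN.
have [u0|u0] := leP 0 u; have [v0|v0] := leP 0 v.
- exact: quadrant_bound.
- have := @quadrant_bound (fun z => F (- 'i%C * z)) a K (- v) u (Jc _) a0 a1.
  rewrite (_ : - 'i%C * (- v +i* u) = u +i* v); last by apply: complex_eq; rewrite ?n1 ?n2 /= ?opprK.
  rewrite sqrrN [_ + u ^+ 2]addrC; apply; [| |lra|lra] => t; [have := F2 (- 'i%C * t)|have := F1 (- 'i%C * t)];
    by rewrite n1 n2 sqrrN addrC.
- have := @quadrant_bound (fun z => F ('i%C * z)) a K v (- u) (Jc _) a0 a1.
  rewrite (_ : 'i%C * (v +i* - u) = u +i* v); last by apply: complex_eq; rewrite ?i1 ?i2 /= ?opprK.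
  rewrite sqrrN [v ^+ 2 + _]addrC; apply; [| |lra|lra] => t; [have := F2 ('i%C * t)|have := F1 ('i%C * t)];
    by rewrite i1 i2 sqrrN addrC.
- have := @quadrant_bound (fun z => F (- 1 * z)) a K (- u) (- v) (Jc _) a0 a1.
  rewrite (_ : - 1 * (- u +i* - v) = u +i* v); last by apply: complex_eq; rewrite ?m1 ?m2 /= ?opprK.
  rewrite !sqrrN; apply; [| |lra|lra] => t; [have := F1 (- 1 * t)|have := F2 (- 1 * t)];
    by rewrite m1 m2 !sqrrN.
Qed.

End Bargmann.

(** * Taylor coefficients of the Bargmann transform and Cauchy's estimate *)

Section Coefficients.
Context {R : realType}.
Local Notation mu := (@lebesgue_measure R).
Implicit Types (f : R -> R[i]) (x y r a C : R) (k N M : nat).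

Lemma horner_expR_bound (p : {poly R}) :
  exists M c : R, 0 <= c /\ forall x, `|p.[x]| <= M * expR (c * `|x|).
Proof.
elim/poly_ind: p => [|p b [M [c [c0 H]]]].
  by exists 0, 0; split => // x; rewrite horner0 normr0 mul0r.
exists (M + `|b|), (c + 1); split => [|x]; first by lra.
rewrite hornerMXaddC (le_trans (ler_normD _ _))// normrM mulrDl lerD//.
  rewrite mulrDl mul1r expRD mulrA ler_pM//.
  by have := expR_ge1Dx `|x|; lra.
rewrite -[leLHS]mulr1 ler_wpM2l// -[leLHS]expR0 ler_expR mulr_ge0//; lra.
Qed.

Lemma measurable_horner (p : {poly R}) : measurable_fun setT (fun x : R => p.[x]).
Proof. by apply: continuous_measurable_fun; exact: continuous_horner. Qed.

Lemma bargmannE f t : gauss_bounded (gauss_weight f) ->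
  bargmann f t = ((Num.sqrt (2 * pi))^-1)%:C *
    cintegral (fun x => gauss_weight f x * cexp ((2 * x)%:C * t - t ^+ 2)).
Proof.
move=> gf; congr (_ * _).
rewrite -(cintegralMl _ (gauss_bounded_cintegrable (gauss_bounded_expz (2 * t) gf))).
congr cintegral; apply/funext => x; rewrite mulrCA -cexpD; congr (_ * cexp _).
by rewrite rmorphM rmorph_nat; ring.
Qed.

Lemma cintegrable_gen f t : gauss_bounded (gauss_weight f) ->
  cintegrable (fun x => gauss_weight f x * cexp ((2 * x)%:C * t - t ^+ 2)).
Proof.
move=> gf.
have := cintegrableMl (cexp (- t ^+ 2)) (gauss_bounded_cintegrable (gauss_bounded_expz (2 * t) gf)).
congr cintegrable; apply/funext => x; rewrite mulrCA -cexpD; congr (_ * cexp _).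
by rewrite rmorphM rmorph_nat; ring.
Qed.

(** The k-th Taylor coefficient of [bargmann f] at 0, given directly as the pairing with the
    coefficient of the generating function, so that no convergence of a Taylor series is
    involved. *)
Definition hermite_coef f k : R[i] := ((Num.sqrt (2 * pi))^-1)%:C *
  cintegral (fun x => gauss_weight f x * ((hpoly k).[x] / k`!%:R)%:C).

Lemma cintegrable_hermite f k : gauss_bounded (gauss_weight f) ->
  cintegrable (fun x => gauss_weight f x * ((hpoly k).[x] / k`!%:R)%:C).
Proof.
move=> gf; have [M [c [c0 H]]] := horner_expR_bound (hpoly k).
apply: gauss_bounded_cintegrable.
apply: (gauss_boundedM gf (M' := M / k`!%:R) (c' := c)) => //.
  apply: cmeasurable_real; apply: measurable_funM => //; exact: measurable_horner.
move=> x; rewrite normc_real normrM (ger0_norm (x := k`!%:R^-1)) ?invr_ge0//.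
by rewrite mulrAC ler_wpM2r// invr_ge0.
Qed.

(* Cauchy's estimate, with the contour integral replaced by the average over
   the [2 M + 1]-st roots of unity, which is exact for the Taylor polynomial of
   order [M]. *)
Lemma hermite_coef_bound_rem f a C k M r B : gauss_bounded (gauss_weight f) ->
  0 < a -> 0 < r -> (forall x, normc (gauss_weight f x) <= C * expR (- a * x ^+ 2 / 2)) ->
  (forall t, normc t = r -> normc (bargmann f t) <= B) -> (k < M)%N ->
  normc (hermite_coef f k) * r ^+ k <= B + (2 ^+ M)^-1 * ((Num.sqrt (2 * pi))^-1 *
    (\int[mu]_x (C * expR (- a * x ^+ 2 / 2 + 4 * r * `|x|)) * expR (2 * r ^+ 2))).
Proof.
move=> gf a0 r0 gC FB kM.
have C0 : 0 <= C.
  by have := le_trans (normc_ge0 _) (gC 0); rewrite pmulr_lge0 ?expR_gt0.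
set s : R[i] := ((Num.sqrt (2 * pi))^-1)%:C.
set I := \int[mu]_x _.
(* The bound of [size_gen_poly], which [coef_root_unity] requires. *)
pose N := (2 * M).+1; pose w := root_unity N : R[i].
have kN : (k < N)%N by rewrite /N ltnS (leq_trans (ltnW kM))// leq_pmull.
pose t j := r%:C * w ^+ j.
have nw j : normc ((w ^+ k) ^+ j) = 1 by rewrite -exprM normc_root_unityX.
have nt j : normc (t j) = r by rewrite normcM normc_real normc_root_unityX mulr1 gtr0_norm.
pose q (x : R) j := (2 * x)%:C * t j - t j ^+ 2.
pose Rem (x : R) := \sum_(j < N) cexp_rem M (q x j) / (w ^+ k) ^+ j.
have split x : \sum_(j < N) gauss_weight f x * cexp (q x j) / (w ^+ k) ^+ j =
    (N%:R * r%:C ^+ k) * (gauss_weight f x * ((hpoly k).[x] / k`!%:R)%:C) + gauss_weight f x * Rem x.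
  have E : \sum_(j < N) (\sum_(n < M) q x j ^+ n / n`!%:R) / (w ^+ k) ^+ j =
      N%:R * (((hpoly k).[x] / k`!%:R)%:C * r%:C ^+ k).
    rewrite -(coef_gen_poly x kM) -[(_`_k)%:C]coef_map -coef_root_unity//.
      by apply: eq_bigr => j _; rewrite gen_polyE.
    by rewrite size_map_poly size_gen_poly.
  transitivity (gauss_weight f x * (N%:R * (((hpoly k).[x] / k`!%:R)%:C * r%:C ^+ k) + Rem x)); last by ring.
  rewrite -E /Rem -big_split /= mulr_sumr; apply: eq_bigr => j _.
  by rewrite /cexp_rem -mulrDl [X in _ * (X / _)]addrC subrK mulrA.
have iT j : cintegrable (fun x => gauss_weight f x * cexp (q x j) / (w ^+ k) ^+ j).
  have := cintegrableMl ((w ^+ k) ^+ j)^-1 (cintegrable_gen (t j) gf).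
  by congr cintegrable; apply/funext => x; rewrite mulrC.
have iH := cintegrable_hermite k gf.
have iS := cintegrable_sum N iT.
have iR : cintegrable (fun x => gauss_weight f x * Rem x).
  have := cintegrableB iS (cintegrableMl (N%:R * r%:C ^+ k) iH).
  by congr cintegrable; apply/funext => x; rewrite split addrAC subrr add0r.
have sumF : \sum_(j < N) bargmann f (t j) / (w ^+ k) ^+ j =
    (N%:R * r%:C ^+ k) * hermite_coef f k + s * cintegral (fun x => gauss_weight f x * Rem x).
  transitivity (s * cintegral (fun x => \sum_(j < N) gauss_weight f x * cexp (q x j) / (w ^+ k) ^+ j)).
    rewrite (cintegral_sum N iT) mulr_sumr; apply: eq_bigr => j _.
    rewrite bargmannE// -mulrA -/s; congr (_ * _).
    rewrite mulrC -cintegralMl; last exact: cintegrable_gen.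
    by congr cintegral; apply/funext => x; rewrite mulrC.
  have -> : (fun x => \sum_(j < N) gauss_weight f x * cexp (q x j) / (w ^+ k) ^+ j) =
    (fun x => (N%:R * r%:C ^+ k) * (gauss_weight f x * ((hpoly k).[x] / k`!%:R)%:C) + gauss_weight f x * Rem x).
    exact/funext.
  rewrite cintegralD//; last exact: cintegrableMl.
  by rewrite cintegralMl// mulrDr /hermite_coef -/s mulrCA.
have iI := integrable_gauss_norm (4 * r) a0.
have iI2 : mu.-integrable setT (EFin \o (fun x => N%:R * ((2 ^+ M)^-1 * expR (2 * r ^+ 2)) * (C * expR (- a * x ^+ 2 / 2 + 4 * r * `|x|)))).
  exact: (integrableZl measurableT (N%:R * ((2 ^+ M)^-1 * expR (2 * r ^+ 2))) (integrableZl measurableT C iI)).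
have Rb : normc (cintegral (fun x => gauss_weight f x * Rem x)) <=
    N%:R * ((2 ^+ M)^-1 * expR (2 * r ^+ 2)) * I.
  rewrite /I -RintegralZl//; last exact: (integrableZl measurableT C iI).
  apply: normc_cintegral_le => // x.
  (* [cexp_taylor] with [l = 2]: twice the bound 2 |x| r + r^2 on |q| is the exponent 4 r |x| + 2
     r^2, and the prefactor 2^-M will send the error to 0. *)
  have rem j : normc (cexp_rem M (q x j) / (w ^+ k) ^+ j) <=
      (2 ^+ M)^-1 * expR (2 * r ^+ 2) * expR (4 * r * `|x|).
    rewrite normcM normcV nw invr1 mulr1 -mulrA -expRD.
    apply: (le_trans (cexp_taylor M (q x j) (l := 2) _)); first by lra.
    rewrite ler_wpM2l ?invr_ge0 ?exprn_ge0// ler_expR.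
    have : normc (q x j) <= 2 * `|x| * r + r ^+ 2.
      by rewrite (le_trans (le_normcB _ _))// normcM normc_real normrM normcX nt (ger0_norm (ler0n _ 2)).
    lra.
  have Rn : normc (Rem x) <= N%:R * ((2 ^+ M)^-1 * expR (2 * r ^+ 2) * expR (4 * r * `|x|)).
    rewrite (le_trans (le_normc_sum _ _ _))// (le_trans (ler_sum _ (fun (j : 'I_N) _ => rem j)))//.
    by rewrite sumr_const card_ord [leRHS]mulr_natl.
  rewrite normcM (le_trans (ler_pM _ _ (gC x) Rn)) ?normc_ge0//.
  by rewrite expRD le_eqVlt; apply/orP; left; apply/eqP; ring.
have N0 : 0 < N%:R :> R by rewrite ltr0n.
rewrite -(ler_pM2l N0).
have -> : N%:R * (normc (hermite_coef f k) * r ^+ k) = normc ((N%:R * r%:C ^+ k) * hermite_coef f k).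
  by rewrite (normcM (_ * _)) (normcM N%:R) normc_nat normcX normc_real (gtr0_norm r0); ring.
have -> : (N%:R * r%:C ^+ k) * hermite_coef f k =
    \sum_(j < N) bargmann f (t j) / (w ^+ k) ^+ j - s * cintegral (fun x => gauss_weight f x * Rem x).
  by rewrite sumF addrK.
rewrite (le_trans (le_normcB _ _))// mulrDr lerD//.
  rewrite (le_trans (le_normc_sum _ _ _))//.
  have Fb (j : 'I_N) : normc (bargmann f (t j) / (w ^+ k) ^+ j) <= B.
    by rewrite normcM normcV nw invr1 mulr1 FB.
  by rewrite (le_trans (ler_sum _ (fun (j : 'I_N) _ => Fb j)))// sumr_const card_ord [leRHS]mulr_natl.
have s0 : 0 <= (Num.sqrt (2 * pi))^-1 :> R by rewrite invr_ge0 sqrtr_ge0.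
rewrite (normcM s) normc_real ger0_norm// (le_trans (ler_wpM2l s0 Rb))//.
by rewrite le_eqVlt; apply/orP; left; apply/eqP; ring.
Qed.

(** The limit of large [M] in [hermite_coef_bound_rem]: the constant [D] does not depend on [M], and
    D / e <= M <= 2^M for [M] large. *)
Lemma hermite_coef_bound f a C k r B : gauss_bounded (gauss_weight f) ->
  0 < a -> 0 < r -> (forall x, normc (gauss_weight f x) <= C * expR (- a * x ^+ 2 / 2)) ->
  (forall t, normc t = r -> normc (bargmann f t) <= B) ->
  normc (hermite_coef f k) * r ^+ k <= B.
Proof.
move=> gf a0 r0 gC FB; set L := leLHS.
have H M : (k < M)%N -> _ := hermite_coef_bound_rem gf a0 r0 gC FB.
move: H; set D := (Num.sqrt _)^-1 * _ => H.
apply/ler_addgt0Pr => e e0.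
pose M := maxn k.+1 (Num.bound (D / e)).
apply: (le_trans (H M _)); first by rewrite leq_max leqnn.
rewrite lerD2l mulrC ler_pdivrMr ?exprn_gt0//.
have D1 : D / e <= M%:R.
  apply: (le_trans (ler_norm _)); apply: ltW.
  apply: (lt_le_trans (archi_boundP (normr_ge0 _))).
  by rewrite ler_nat (leq_trans _ (leq_maxr _ _))// /Num.bound normr_id.
have D2 : M%:R <= 2 ^+ M :> R by rewrite -natrX ler_nat ltnW// ltn_expl.
by rewrite mulrC -ler_pdivrMr// (le_trans D1).
Qed.

Lemma cintegral_ae_eq (f g : R -> R[i]) : cmeasurable f -> cmeasurable g ->
  {ae mu, forall x, f x = g x} -> cintegral f = cintegral g.
Proof.
move=> [f1 f2] [g1 g2] fg; apply: complex_eq; congr fine.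
- apply: ae_eq_integral => //; [exact/measurable_EFinP|exact/measurable_EFinP|].
  by apply: (@filterS _ _ (ae_filter_ringOfSetsType mu) _ _ _ fg) => x -> _.
- apply: ae_eq_integral => //; [exact/measurable_EFinP|exact/measurable_EFinP|].
  by apply: (@filterS _ _ (ae_filter_ringOfSetsType mu) _ _ _ fg) => x -> _.
Qed.

Lemma measurable_hermite_fun k : cmeasurable (@hermite_fun R k).
Proof.
apply: cmeasurable_real; apply: measurable_funM.
  apply: measurable_funM => //.
  have -> : hermite k = (fun x : R => (hpoly k).[x]) by apply/funext => x; rewrite hermite_hpoly.
  exact: measurable_horner.
apply: measurableT_comp => //; apply: measurable_funM => //.
by apply: measurableT_comp => //; exact: measurable_funX.
Qed.

Lemma inner_hermite_fun f k : gauss_bounded (gauss_weight f) ->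
  inner f (hermite_fun k) =
  (2 `^ (4^-1) * (Num.sqrt (2 ^+ k * k`!%:R))^-1 * k`!%:R)%:C * hermite_coef f k.
Proof.
move=> gf; have f0 : (k`!%:R : R) != 0 by rewrite pnatr_eq0 -lt0n fact_gt0.
rewrite /hermite_coef mulrA -cintegralMl; last exact: cintegrable_hermite.
congr cintegral; apply/funext => x.
have -> : Num.conj (hermite_fun k x) = hermite_fun k x.
  by rewrite conj_Creal// /hermite_fun complex_real.
rewrite /hermite_fun hermite_hpoly /gauss_weight -[- x ^+ 2]mulN1r.
set A := 2 `^ _ * _; set E := expR _; set s := (Num.sqrt (2 * pi))^-1; set h := _.[x].
have -> : (A * h * E : R) = A * k`!%:R * (E * (h / k`!%:R)) by field.
rewrite !rmorphM /=; ring.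
Qed.

End Coefficients.

(** * Optimal radius, constants and conclusion *)

Section Final.
Context {R : realType}.
Local Notation mu := (@lebesgue_measure R).

Lemma sqrt_powR (b : R) k : 0 <= b -> b `^ (k%:R / 2) = Num.sqrt b ^+ k.
Proof. by move=> b0; rewrite mulrC powRrM powR12_sqrt// powR_mulrn// sqrtr_ge0. Qed.

Lemma sqrt_sqrt_powR (b : R) k : 0 <= b -> b `^ (k%:R / 4) = Num.sqrt (Num.sqrt b) ^+ k.
Proof.
move=> b0; have -> : (k%:R / 4 : R) = 2^-1 * (k%:R / 2) by field.
by rewrite powRrM powR12_sqrt// sqrt_powR// sqrtr_ge0.
Qed.

(* [r ^ 2 = k / (2 s)] minimizes [exp (s r ^ 2) / r ^ k]. *)
Lemma optimal_radius (K X s : R) k : (0 < k)%N -> 0 < s ->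
  (forall r, 0 < r -> X * r ^+ k <= K * expR (s * r ^+ 2)) ->
  X <= K * (Num.sqrt (expR 1 / k%:R) * Num.sqrt 2 * Num.sqrt s) ^+ k.
Proof.
move=> k0 s0 H; have k0' : 0 < k%:R :> R by rewrite ltr0n.
pose r := Num.sqrt (k%:R / (2 * s)).
have r0 : 0 < r by rewrite sqrtr_gt0 divr_gt0// mulr_gt0.
have := H r r0; rewrite sqr_sqrtr; last by rewrite divr_ge0 ?mulr_ge0 ?ltW.
rewrite (_ : s * (k%:R / (2 * s)) = k%:R * 2^-1); last by field; rewrite gt_eqF.
move=> H1; have {}H1 : X <= K * (expR 2^-1 / r) ^+ k.
  by rewrite expr_div_n mulrA ler_pdivlMr ?exprn_gt0// -expRM_natl.
apply: (le_trans H1).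
rewrite le_eqVlt; apply/orP; left; apply/eqP; congr (_ * _ ^+ _).
have -> : expR (2^-1 : R) = Num.sqrt (expR 1).
  by rewrite -[LHS]ger0_norm ?expR_ge0// -sqrtr_sqr -expRM_natl divff.
rewrite /r -sqrtrV ?divr_ge0 ?mulr_ge0 ?(ltW s0) ?(ltW k0')// -!sqrtrM ?divr_ge0 ?mulr_ge0 ?expR_ge0//.
by congr Num.sqrt; field; rewrite gt_eqF//= gt_eqF.
Qed.

Lemma powR_quarter_le : 2 `^ (4^-1) <= Num.sqrt (2 * pi) :> R.
Proof.
apply: (@le_trans _ _ (2 `^ 2^-1)); first by apply: ler_powR; lra.
by rewrite powR12_sqrt// ler_wsqrtr// ler_peMr//; have := pihalf_ge1 R; lra.
Qed.

(** The power of sqrt 2 from the optimal radius cancels the one in the normalization of the Hermite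
    function, and k! / sqrt (k!) leaves sqrt (k!). Only 2^(1/4) <= sqrt (2 pi) is an inequality. *)
Lemma final_constant (a C : R) k : 0 < a -> a < 1 -> 0 <= C -> (0 < k)%N ->
  2 `^ (4^-1) * (Num.sqrt (2 ^+ k * k`!%:R))^-1 * k`!%:R *
    (C / Num.sqrt (1 + a) *
      (Num.sqrt (expR 1 / k%:R) * Num.sqrt 2 * Num.sqrt (Num.sqrt ((1 - a) / (1 + a)))) ^+ k) <=
  C * Num.sqrt (2 * pi * k`!%:R / (1 + a)) * (expR 1 / k%:R) `^ (k%:R / 2)
    * ((1 - a) / (1 + a)) `^ (k%:R / 4).
Proof.
move=> a0 a1 C0 k0; have pi2 : 0 < 2 * pi :> R by rewrite mulr_gt0 ?pi_gt0.
have a1' : 0 < 1 + a by lra.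
rewrite sqrt_powR ?divr_ge0 ?expR_ge0// sqrt_sqrt_powR; last by rewrite divr_ge0; lra.
set E := Num.sqrt (expR 1 / _); set S := Num.sqrt (Num.sqrt _).
have f0 : 0 < k`!%:R :> R by rewrite ltr0n fact_gt0.
have E0 : 0 <= E ^+ k by rewrite exprn_ge0 ?sqrtr_ge0.
have S0 : 0 <= S ^+ k by rewrite exprn_ge0 ?sqrtr_ge0.
pose F : R := Num.sqrt (k`!%:R : R); have F0 : 0 < F by rewrite sqrtr_gt0.
set A := Num.sqrt (1 + a); have A0 : 0 < A by rewrite sqrtr_gt0.
have FF : F * F = k`!%:R by rewrite -expr2 sqr_sqrtr// ltW.
have -> : Num.sqrt (2 * pi * k`!%:R / (1 + a)) = Num.sqrt (2 * pi) * F / A.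
  have p1 : 0 <= 2 * pi * k`!%:R :> R by exact: mulr_ge0 (ltW pi2) (ltW f0).
  by rewrite (sqrtrM _ p1) (sqrtrM _ (ltW pi2)) (sqrtrV (ltW a1')).
have T0 : 0 < Num.sqrt 2 ^+ k :> R by rewrite exprn_gt0 ?sqrtr_gt0.
have -> : Num.sqrt (2 ^+ k * k`!%:R) = Num.sqrt 2 ^+ k * F.
  rewrite sqrtrM ?exprn_ge0//; congr (_ * _).
  by rewrite -[RHS]ger0_norm ?exprn_ge0// -sqrtr_sqr -exprM mulnC exprM sqr_sqrtr.
rewrite !exprMn -FF.
have -> : 2 `^ 4^-1 / (Num.sqrt 2 ^+ k * F) * (F * F) * (C / A * (E ^+ k * Num.sqrt 2 ^+ k * S ^+ k)) =
    2 `^ 4^-1 * (C * F / A * E ^+ k * S ^+ k).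
  by field; rewrite !gt_eqF.
have -> : C * (Num.sqrt (2 * pi) * F / A) * E ^+ k * S ^+ k =
    Num.sqrt (2 * pi) * (C * F / A * E ^+ k * S ^+ k) by ring.
rewrite ler_wpM2r ?powR_quarter_le//.
by rewrite !mulr_ge0// ?invr_ge0 ltW.
Qed.

(** The case of a bound on [f] at every point, to which the almost everywhere bound is reduced by
    changing [f] on a null set. *)
Lemma inner_bound (f : R -> R[i]) (a C : R) k : 0 < a -> a < 1 -> (0 < k)%N ->
  cmeasurable f -> cintegrable f ->
  (forall x, normc (f x) <= C * expR (- a * x ^+ 2 / 2)) ->
  (forall x, normc (fourier f x) <= C * expR (- a * x ^+ 2 / 2)) ->
  normc (inner f (hermite_fun k)) <=
  C * Num.sqrt (2 * pi * k`!%:R / (1 + a)) * (expR 1 / k%:R) `^ (k%:R / 2)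
    * ((1 - a) / (1 + a)) `^ (k%:R / 4).
Proof.
move=> a0 a1 k0 mf If fC FC; have gf := gauss_bounded_weight mf a0 fC.
have C0 : 0 <= C.
  by have := le_trans (normc_ge0 _) (fC 0); rewrite pmulr_lge0 ?expR_gt0.
have a1' : 0 < 1 + a by lra.
have s0 : 0 < Num.sqrt ((1 - a) / (1 + a)) by rewrite sqrtr_gt0 divr_gt0//; lra.
have gC x := normc_gauss_weight_le (fC x).
have coef : normc (hermite_coef f k) <= C / Num.sqrt (1 + a) *
    (Num.sqrt (expR 1 / k%:R) * Num.sqrt 2 * Num.sqrt (Num.sqrt ((1 - a) / (1 + a)))) ^+ k.
  apply: optimal_radius => // r r0.
  apply: (@hermite_coef_bound _ f (1 + a) C k r _ gf a1' r0 gC) => t <-.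
  apply: plane_bound => // z.
  - exact: jet2_bargmann.
  - exact: bargmann_bound.
  - exact: bargmann_fourier_bound.
apply: le_trans (final_constant a0 a1 C0 k0).
rewrite inner_hermite_fun// normcM normc_real ger0_norm.
  by rewrite ler_wpM2l// !mulr_ge0// ?invr_ge0 ?sqrtr_ge0// powR_ge0.
by rewrite !mulr_ge0// ?invr_ge0 ?sqrtr_ge0// powR_ge0.
Qed.

End Final.

Unset Implicit Arguments.

Theorem theorem2p1 (R : realType) (a C : R) (f : R -> R[i])
  (ha0 : 0 < a) (ha1 : a < 1)
  (hf : cintegrable f)
  (hfC : {ae (@lebesgue_measure R), forall x,
            `|f x| <= (C * expR (- a * x ^+ 2 / 2))%:C})
  (hfhat : forall xi : R,
            `|fourier f xi| <= (C * expR (- a * xi ^+ 2 / 2))%:C)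
  (k : nat) (hk : (1 <= k)%N) :
  `|inner f (hermite_fun k)| <=
    (C * Num.sqrt (2 * pi * k`!%:R / (1 + a))
       * (expR 1 / k%:R) `^ (k%:R / 2)
       * ((1 - a) / (1 + a)) `^ (k%:R / 4))%:C.
Proof.
pose b x : R := C * expR (- a * x ^+ 2 / 2).
have mf := cintegrable_cmeasurable hf.
(* Setting [f] to 0 where the bound fails changes neither the inner product nor the Fourier
   transform, and makes the bound hold everywhere. *)
pose f' x : R[i] := if normc (f x) <= b x then f x else 0.
have mb : measurable_fun setT b.
  apply: measurable_funM => //.
  by have := measurable_gauss_norm a 0; under eq_fun do rewrite mul0r addr0.
have mn : measurable_fun setT (fun x => normc (f x)).
  case: mf => f1 f2; under eq_fun do rewrite normcE.
  apply: (@measurableT_comp _ _ _ _ _ _ (@Num.sqrt R)).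
    by apply: continuous_measurable_fun; exact: sqrt_continuous.
  by apply: measurable_funD; exact: measurable_funX.
have mB : measurable_fun setT (fun x => normc (f x) <= b x) by exact: measurable_fun_ler.
have mf' : cmeasurable f'.
  case: mf => f1 f2; split.
  - have -> : (fun x => Re (f' x)) = (fun x => if normc (f x) <= b x then Re (f x) else 0).
      by apply/funext => x; rewrite /f'; case: ifP.
    exact: measurable_fun_ifT.
  - have -> : (fun x => Im (f' x)) = (fun x => if normc (f x) <= b x then Im (f x) else 0).
      by apply/funext => x; rewrite /f'; case: ifP.
    exact: measurable_fun_ifT.
(* Read off the bound on the Fourier transform, which holds at every point; it is what lets the
   value 0 of [f'] satisfy the bound. *)
have C0 : 0 <= C.
  have := hfhat 0; rewrite normc_norm lecR => /(le_trans (normc_ge0 _)).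
  by rewrite pmulr_lge0 ?expR_gt0.
have fb x : normc (f' x) <= b x.
  by rewrite /f'; case: ifP => // _; rewrite normc0 mulr_ge0 ?expR_ge0.
have ff' : {ae (@lebesgue_measure R), forall x, f x = f' x}.
  apply: (@filterS _ _ (ae_filter_ringOfSetsType _) _ _ _ hfC) => x.
  by rewrite /f' normc_norm lecR => ->.
have iE (g : R -> R[i]) : cmeasurable g ->
    cintegral (fun x => f x * g x) = cintegral (fun x => f' x * g x).
  move=> mg; apply: cintegral_ae_eq; [exact: cmeasurableM|exact: cmeasurableM|].
  by apply: (@filterS _ _ (ae_filter_ringOfSetsType _) _ _ _ ff') => x ->.
have innerE : inner f (hermite_fun k) = inner f' (hermite_fun k).
  have mg : cmeasurable (fun x : R => hermite_fun k x * ((Num.sqrt (2 * pi))^-1)%:C).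
    by apply: cmeasurableM; [exact: measurable_hermite_fun|exact: cmeasurable_cst].
  have hE x : Num.conj (hermite_fun k x) = hermite_fun k x :> R[i].
    by rewrite conj_Creal// /hermite_fun complex_real.
  have innE h : inner h (hermite_fun k) =
      cintegral (fun x : R => h x * (hermite_fun k x * ((Num.sqrt (2 * pi))^-1)%:C)).
    by congr cintegral; apply/funext => x; rewrite hE mulrA.
  by rewrite !innE; exact: iE.
have fourE xi : fourier f xi = fourier f' xi.
  congr (_ * _); apply: (iE (fun x => expi (- (xi * x)))); apply: cmeasurable_expi.
  by apply: measurableT_comp => //; exact: measurable_funM.
rewrite innerE normc_norm lecR; apply: inner_bound => //.
- apply: (cintegrable_le mf' (h := b)) => //.
  have := integrableZl measurableT C (integrable_gauss_norm 0 ha0).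
  by congr (_.-integrable _ _); apply/funext => x; rewrite /= mul0r addr0.
- by move=> xi; have := hfhat xi; rewrite fourE normc_norm lecR.
Qed.
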